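(* Let $\rho:\pi_1^{\mathrm{orb}}(T^8/\Gamma)\to SO(4)$ be a representation with $\rho(\alpha)=\rho(\beta)=1$ and such that $\rho(\gamma)$ and $\rho(\delta)$ commute, with at least one of them non-trivial. If the image of $\{\tau_i\}_{i=1,\dots,8}$ (the subgroup of $SO(4)$ generated by the commuting involutions $\rho(\tau_i)$) contains a Klein four-subgroup not containing the central inversion $-1$, then $\rho$ is valid for the construction, i.e. the associated flat connection is irreducible, infinitesimally rigid and unobstructed.
   Context: $\pi_1^{\mathrm{orb}}(T^8/\Gamma)$ is the group of affine isometries of $\mathbb R^8$ generated by $\alpha:(x_1,\dots,x_8)\mapsto(-x_1,-x_2,-x_3,-x_4,x_5,x_6,x_7,x_8)$, $\beta:\ \mapsto(x_1,x_2,x_3,x_4,-x_5,-x_6,-x_7,-x_8)$, $\gamma:\ \mapsto(\frac12-x_1,\frac12-x_2,x_3,x_4,\frac12-x_5,\frac12-x_6,x_7,x_8)$, $\delta:\ \mapsto(-x_1,x_2,\frac12-x_3,x_4,\frac12-x_5,x_6,\frac12-x_7,x_8)$, and the unit translations $\tau_i:x_i\mapsto x_i+1$ ($i=1,\dots,8$). $\Gamma$ is the group generated by $\alpha,\beta,\gamma,\delta$ acting on $T^8=\mathbb R^8/\mathbb Z^8$. The flat $Spin(7)$-structure on $T^8/\Gamma$ is (with $dx_{ijkl}=dx_i\wedge dx_j\wedge dx_k\wedge dx_l$) $\Omega_0=dx_{1234}+dx_{1256}+dx_{1278}+dx_{1357}-dx_{1368}-dx_{1458}-dx_{1467}-dx_{2358}-dx_{2367}-dx_{2457}+dx_{2468}+dx_{3456}+dx_{3478}+dx_{5678}$;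 $\Lambda^2_7$ is the rank 7 eigenspace of $\omega\mapsto*(\Omega_0\wedge\omega)$ on 2-forms with eigenvalue $3$, and $\pi^2_7$ the orthogonal projection onto it. A homomorphism $\rho$ to $G$ determines an orbifold $G$-bundle $E_0=(\mathbb R^8\times G)/\pi_1^{\mathrm{orb}}(T^8/\Gamma)$ over $T^8/\Gamma$ with flat connection $\theta$, the flat connection associated with $\rho$. Let $\mathcal H^i_\theta$ be the cohomology of $0\to\Gamma(\mathrm{Ad}E_0)\xrightarrow{d_\theta}\Gamma(\Lambda^1\otimes\mathrm{Ad}E_0)\xrightarrow{\pi^2_7d_\theta}\Gamma(\Lambda^2_7\otimes\mathrm{Ad}E_0)\to0$ (sections on the orbifold are the equivariant ones upstairs). $\theta$ is irreducible if $\mathcal H^0_\theta=0$, infinitesimally rigid if $\mathcal H^1_\theta=0$, unobstructed if $\mathcal H^2_\theta=0$. *)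

(* Defs.v *)
From HB Require Import structures.
From mathcomp Require Import all_boot all_order all_algebra.
From mathcomp Require Import all_classical all_reals all_analysis.

Set Implicit Arguments.
Unset Strict Implicit.
Unset Printing Implicit Defensive.

Import Order.TTheory GRing.Theory Num.Theory.
Import numFieldNormedType.Exports.

Local Open Scope classical_set_scope.
Local Open Scope ring_scope.

Section Groups.
Variable G : groupType.

Definition subgroup_set (H : set G) : Prop :=
  H 1%g /\ (forall x y, H x -> H y -> H (x / y)%g).

Definition generated (S : set G) : set G := smallest subgroup_set S.

Lemma generated_subgroup (S : set G) : subgroup_set (generated S).
Proof.
split; first by move=> H [[H1 _] _].
move=> x y Sx Sy H HP; have [[_ HV] _] := HP.
by apply: HV; [exact: Sx HP | exact: Sy HP].
Qed.

Lemma mem_generated (S : set G) x : S x -> generated S x.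
Proof. exact: (@sub_gen_smallest _ _ S x). Qed.

Definition klein_four (K : set G) : Prop :=
  exists a b : G,
    [/\ (a * a = 1)%g, (b * b = 1)%g & (a * b = b * a)%g] /\
    [/\ a <> 1%g, b <> 1%g & a <> b] /\
    K = [set x | [\/ x = 1%g, x = a, x = b | x = (a * b)%g]].

End Groups.

Section SpecialOrthogonal.
Variables (R : realType) (n : nat).

Definition SO_pred (A : 'M[R]_n) : bool :=
  (A *m A^T == 1%:M) && (\det A == 1).

Record SO := MkSO { SO_val :> 'M[R]_n ; SO_valP : SO_pred SO_val }.

HB.instance Definition _ := [isSub of SO for SO_val].
HB.instance Definition _ := [Choice of SO by <:].

Lemma SO_mulT (A : SO) : (A : 'M[R]_n) *m A^T = 1%:M.
Proof. by case: A => A /= /andP[/eqP]. Qed.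

Lemma SO_det (A : SO) : \det (A : 'M[R]_n) = 1.
Proof. by case: A => A /= /andP[_ /eqP]. Qed.

Lemma SO_Tmul (A : SO) : A^T *m (A : 'M[R]_n) = 1%:M.
Proof. exact/mulmx1C/SO_mulT. Qed.

Fact SO_one_subproof : SO_pred 1%:M.
Proof. by rewrite /SO_pred trmx1 mulmx1 det1 !eqxx. Qed.

Fact SO_mul_subproof (A B : SO) : SO_pred (A *m B).
Proof.
rewrite /SO_pred trmx_mul mulmxA -(mulmxA _ (B : 'M[R]_n)) SO_mulT mulmx1 SO_mulT.
by rewrite det_mulmx !SO_det mulr1 !eqxx.
Qed.

Fact SO_inv_subproof (A : SO) : SO_pred A^T.
Proof. by rewrite /SO_pred trmxK SO_Tmul det_tr SO_det !eqxx. Qed.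

Definition SO_one := MkSO SO_one_subproof.
Definition SO_mul A B := MkSO (SO_mul_subproof A B).
Definition SO_inv A := MkSO (SO_inv_subproof A).

Fact SO_mulA : associative SO_mul.
Proof. by move=> A B C; apply/val_inj; rewrite /= mulmxA. Qed.
Fact SO_mul1g : left_id SO_one SO_mul.
Proof. by move=> A; apply/val_inj; rewrite /= mul1mx. Qed.
Fact SO_mulg1 : right_id SO_one SO_mul.
Proof. by move=> A; apply/val_inj; rewrite /= mulmx1. Qed.
Fact SO_mulVg : left_inverse SO_one SO_inv SO_mul.
Proof. by move=> A; apply/val_inj; rewrite /= SO_Tmul. Qed.
Fact SO_mulgV : right_inverse SO_one SO_inv SO_mul.
Proof. by move=> A; apply/val_inj; rewrite /= SO_mulT. Qed.

HB.instance Definition _ :=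
  isGroup.Build SO SO_mulA SO_mul1g SO_mulg1 SO_mulVg SO_mulgV.

Definition so_alg : set 'M[R]_n := [set X | X^T = - X].

Definition Ad (A : SO) (X : 'M[R]_n) : 'M[R]_n := A *m X *m (A^-1)%g.

End SpecialOrthogonal.

Section CentralInversion.
Variable R : realType.

Fact SO4_opp1_subproof : SO_pred (- 1%:M : 'M[R]_4).
Proof.
rewrite /SO_pred linearN /= trmx1 mulNmx mulmxN opprK mulmx1 eqxx /=.
by rewrite -scaleN1r detZ det1 mulr1 -signr_odd expr0.
Qed.

Definition SO4_opp1 : SO R 4 := MkSO SO4_opp1_subproof.

End CentralInversion.

Section AffineIsometries.
Variables (R : realType) (n : nat).

(* The pair (A, b) stands for the affine isometry x |-> A x + b. *)
Definition affiso_pred (g : 'M[R]_n * 'cV[R]_n) : bool :=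
  g.1 *m g.1^T == 1%:M.

Record affiso := MkAff {
  aff_val :> 'M[R]_n * 'cV[R]_n ; aff_valP : affiso_pred aff_val }.

HB.instance Definition _ := [isSub of affiso for aff_val].
HB.instance Definition _ := [Choice of affiso by <:].

Definition lin (g : affiso) : 'M[R]_n := (aff_val g).1.
Definition trans (g : affiso) : 'cV[R]_n := (aff_val g).2.

Definition aff_act (g : affiso) (x : 'cV[R]_n) : 'cV[R]_n :=
  lin g *m x + trans g.

Lemma lin_mulT (g : affiso) : lin g *m (lin g)^T = 1%:M.
Proof. exact/eqP/(aff_valP g). Qed.

Lemma lin_Tmul (g : affiso) : (lin g)^T *m lin g = 1%:M.
Proof. exact/mulmx1C/lin_mulT. Qed.

Fact aff_one_subproof : affiso_pred (1%:M, 0).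
Proof. by rewrite /affiso_pred /= trmx1 mulmx1. Qed.

Fact aff_mul_subproof (g h : affiso) :
  affiso_pred (lin g *m lin h, lin g *m trans h + trans g).
Proof.
rewrite /affiso_pred /= trmx_mul mulmxA -(mulmxA _ (lin h)).
by rewrite lin_mulT mulmx1 lin_mulT.
Qed.

Fact aff_inv_subproof (g : affiso) :
  affiso_pred ((lin g)^T, - ((lin g)^T *m trans g)).
Proof. by rewrite /affiso_pred /= trmxK lin_Tmul. Qed.

Definition aff_one := MkAff aff_one_subproof.
Definition aff_mul g h := MkAff (aff_mul_subproof g h).
Definition aff_inv g := MkAff (aff_inv_subproof g).

Fact aff_mulA : associative aff_mul.
Proof.
move=> f g h; apply/val_inj; rewrite /= /lin /trans /=.
by rewrite mulmxA mulmxDr mulmxA addrA.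
Qed.
Fact aff_mul1g : left_id aff_one aff_mul.
Proof.
move=> g; apply/val_inj; rewrite /= /lin /trans /= !mul1mx addr0.
by case: (aff_val g).
Qed.
Fact aff_mulg1 : right_id aff_one aff_mul.
Proof.
move=> g; apply/val_inj; rewrite /= /lin /trans /= mulmx1 mulmx0 add0r.
by case: (aff_val g).
Qed.
Fact aff_mulVg : left_inverse aff_one aff_inv aff_mul.
Proof.
move=> g; apply/val_inj.
by rewrite /= {1 2}/lin /trans /= lin_Tmul subrr.
Qed.
Fact aff_mulgV : right_inverse aff_one aff_inv aff_mul.
Proof.
move=> g; apply/val_inj => /=.
rewrite [lin (aff_inv g)]/lin [trans (aff_inv g)]/trans /=.
by rewrite lin_mulT mulmxN mulmxA lin_mulT mul1mx addNr.
Qed.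

HB.instance Definition _ :=
  isGroup.Build affiso aff_mulA aff_mul1g aff_mulg1 aff_mulVg aff_mulgV.

Lemma aff_actM (g h : affiso) x :
  aff_act (g * h)%g x = aff_act g (aff_act h x).
Proof.
rewrite /aff_act [lin (g * h)%g]/lin [trans (g * h)%g]/trans /=.
by rewrite mulmxDr mulmxA addrA.
Qed.

Lemma aff_act1 x : aff_act 1%g x = x.
Proof. by rewrite /aff_act /lin /trans /= mul1mx addr0. Qed.

Lemma aff_act_inj (g h : affiso) : aff_act g =1 aff_act h -> g = h.
Proof.
move=> gh; have tE : trans g = trans h.
  by have := gh 0; rewrite /aff_act !mulmx0 !add0r.
have lE : lin g = lin h.
  apply/matrixP => i j; have := gh (delta_mx j 0).
  rewrite /aff_act tE => /addIr /matrixP /(_ i 0).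
  by rewrite -!colE !mxE.
apply/val_inj; move: lE tE; rewrite /= /lin /trans.
by case: (aff_val g) => ? ?; case: (aff_val h) => ? ? /= -> ->.
Qed.

End AffineIsometries.

Section OrbifoldGroup.
Variable R : realType.

(* x_i |-> - x_i for i in s, followed by x_i |-> x_i + b_i;
   the coordinates are numbered from 1. *)
Definition signs (s : seq nat) : 'rV[R]_8 :=
  \row_i (if i.+1 \in s then -1 else 1).

Fact signed_shift_subproof (s : seq nat) (b : 'cV[R]_8) :
  affiso_pred (diag_mx (signs s), b).
Proof.
rewrite /affiso_pred /= tr_diag_mx; apply/eqP/matrixP => i j.
rewrite mul_diag_mx !mxE; case: eqP => [->|_]; last by rewrite mulr0n mulr0.
by case: ifP; rewrite !mulr1n ?mulrNN mulr1.
Qed.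

Definition signed_shift s b : affiso R 8 := MkAff (signed_shift_subproof s b).

Definition halves (s : seq nat) : 'cV[R]_8 :=
  \col_i (if i.+1 \in s then 2^-1 else 0).

Lemma signed_shiftE s b x i :
  aff_act (signed_shift s b) x i 0 =
  (if i.+1 \in s then - x i 0 else x i 0) + b i 0.
Proof.
rewrite /aff_act /lin /trans /= !mxE; congr (_ + _).
rewrite (bigD1 i) //= big1 => [|j ji].
  by rewrite !mxE eqxx addr0; case: ifP; rewrite mulr1n ?mulN1r ?mul1r.
by rewrite !mxE eq_sym (negPf ji) mulr0n mul0r.
Qed.

Definition alpha_aff := signed_shift [:: 1; 2; 3; 4]%N 0.
Definition beta_aff := signed_shift [:: 5; 6; 7; 8]%N 0.
Definition gamma_aff :=
  signed_shift [:: 1; 2; 5; 6]%N (halves [:: 1; 2; 5; 6]%N).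
Definition delta_aff :=
  signed_shift [:: 1; 3; 5; 7]%N (halves [:: 3; 5; 7]%N).
Definition tau_aff (i : 'I_8) := signed_shift [::] (delta_mx i 0).

Definition pi1_generators : set (affiso R 8) :=
  [set alpha_aff; beta_aff; gamma_aff; delta_aff] `|` range tau_aff.

Definition pi1_pred : pred (affiso R 8) :=
  fun g => `[< generated pi1_generators g >].

Record pi1orb := MkPi1 { pi1_val :> affiso R 8 ; pi1_valP : pi1_pred pi1_val }.

HB.instance Definition _ := [isSub of pi1orb for pi1_val].
HB.instance Definition _ := [Choice of pi1orb by <:].

Fact pi1_group_closed : group_closed pi1_pred.
Proof.
have [g1 gV] := generated_subgroup pi1_generators.
split; first exact/asboolP.
move=> g h Pg Ph; rewrite unfold_in; apply/asboolP.
by apply: gV; exact/asboolP.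
Qed.

HB.instance Definition _ :=
  SubChoice_isSubGroup.Build (affiso R 8) pi1_pred pi1orb pi1_group_closed.

Fact alpha_subproof : pi1_pred alpha_aff.
Proof. by apply/asboolP; apply: mem_generated; left; left; left; left. Qed.
Fact beta_subproof : pi1_pred beta_aff.
Proof. by apply/asboolP; apply: mem_generated; left; left; left; right. Qed.
Fact gamma_subproof : pi1_pred gamma_aff.
Proof. by apply/asboolP; apply: mem_generated; left; left; right. Qed.
Fact delta_subproof : pi1_pred delta_aff.
Proof. by apply/asboolP; apply: mem_generated; left; right. Qed.
Fact tau_subproof i : pi1_pred (tau_aff i).
Proof. by apply/asboolP; apply: mem_generated; right; exists i. Qed.

Definition alpha : pi1orb := MkPi1 alpha_subproof.
Definition beta : pi1orb := MkPi1 beta_subproof.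
Definition gamma : pi1orb := MkPi1 gamma_subproof.
Definition delta : pi1orb := MkPi1 delta_subproof.
Definition tau (i : 'I_8) : pi1orb := MkPi1 (tau_subproof i).

End OrbifoldGroup.

(* A form with constant coefficients on R^n is w = \sum_I w_I dx_I, where I
   ranges over the subsets of 'I_n and dx_I is the wedge product of the dx_i,
   i in I, in increasing order. *)
Section ExteriorAlgebra.
Variables (R : realType) (n : nat).

Definition form (V : Type) := {ffun {set 'I_n} -> V}.

Definition is_kform (V : lmodType R) (k : nat) (w : form V) : Prop :=
  forall I : {set 'I_n}, #|I| != k -> w I = 0.

(* dx_I /\ dx_J = shuffle_sign I J *: dx_(I :|: J) for disjoint I and J *)
Definition shuffle_sign (I J : {set 'I_n}) : R :=
  (-1) ^+ #|[set p : 'I_n * 'I_n | [&& p.1 \in I, p.2 \in J & p.2 < p.1]%N]|.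

Definition wedge (V : lmodType R) (a : form R) (w : form V) : form V :=
  [ffun K : {set 'I_n} => \sum_(I : {set 'I_n} | I \subset K)
     (shuffle_sign I (K :\: I) * a I) *: w (K :\: I)].

(* dx_I /\ * dx_I = dx_1 /\ ... /\ dx_n *)
Definition hodge (V : lmodType R) (w : form V) : form V :=
  [ffun J : {set 'I_n} => shuffle_sign (~: J) J *: w (~: J)].

Definition pairing (V : lmodType R) (z : form R) (w : form V) : V :=
  \sum_(I : {set 'I_n}) z I *: w I.

Definition one_form : form R := [ffun I : {set 'I_n} => (I == finset.set0)%:R].

Definition dx (i : 'I_n) : form R :=
  [ffun I : {set 'I_n} => (I == [set i]%SET)%:R].

(* The entries of enum I are increasing; minor A I J is only used for
   #|I| = #|J|. *)
Definition minor (A : 'M[R]_n) (I J : {set 'I_n}) : R :=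
  \det (\matrix_(a < #|I|, b < #|I|)
     A (enum_val a) (nth (enum_val a) (enum J) b)).

(* A^* dx_I = \sum_(J | #|J| = #|I|) minor A I J *: dx_J *)
Definition lin_pull (V : lmodType R) (A : 'M[R]_n) (w : form V) : form V :=
  [ffun J : {set 'I_n} => \sum_(I : {set 'I_n} | #|I| == #|J|)
     minor A I J *: w I].

End ExteriorAlgebra.

Section Spin7.
Variable R : realType.

(* dx_{ijkl} for i, j, k, l in {1, ..., 8} *)
Definition dx4 (i j k l : nat) : form 8 R :=
  let d m := dx R (inord m.-1 : 'I_8) in
  wedge (d i) (wedge (d j) (wedge (d k) (d l))).

Definition Omega0 : form 8 R :=
  dx4 1 2 3 4 + dx4 1 2 5 6 + dx4 1 2 7 8 + dx4 1 3 5 7 - dx4 1 3 6 8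
  - dx4 1 4 5 8 - dx4 1 4 6 7 - dx4 2 3 5 8 - dx4 2 3 6 7 - dx4 2 4 5 7
  + dx4 2 4 6 8 + dx4 3 4 5 6 + dx4 3 4 7 8 + dx4 5 6 7 8.

(* Lambda^2_7 (x) V *)
Definition Lambda27 (V : lmodType R) : set (form 8 V) :=
  [set w | is_kform 2 w /\ hodge (wedge Omega0 w) = 3%:R *: w].

(* (orthogonal projection onto Lambda^2_7) (x) id_V: the basis (dx_I) is
   orthonormal, so the image of a 2-form w is the unique e in Lambda^2_7 (x) V
   with w - e orthogonal to Lambda^2_7. *)
Definition pi27 (V : lmodType R) (w : form 8 V) : form 8 V :=
  xget 0 [set e | Lambda27 e /\
                  forall z : form 8 R, Lambda27 z -> pairing z (w - e) = 0].

End Spin7.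

Section DifferentialForms.
Variables (R : realType) (m : nat).
Local Notation n := m.+1.
Local Notation E := 'cV[R]_n.

Definition partial (V : normedModType R) (i : 'I_n) (f : E -> V) : E -> V :=
  fun x => 'D_(delta_mx i 0) f x.

Definition smooth (V : normedModType R) (f : E -> V) : Prop :=
  forall (s : seq 'I_n) (x : E), differentiable (foldr (partial (V:=V)) f s) x.

Definition smooth_form (V : normedModType R) (w : E -> form n V) : Prop :=
  forall I, smooth (fun x => w x I).

Definition ext_d (V : normedModType R) (w : E -> form n V) : E -> form n V :=
  fun x => \sum_(i < n)
    wedge (dx R i) [ffun I => partial i (fun y => w y I) x].

Definition pullback (V : lmodType R) (g : affiso R n) (w : E -> form n V) :
    E -> form n V :=
  fun x => lin_pull (lin g) (w (aff_act g x)).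

End DifferentialForms.

Section Deformation.
Variables (R : realType) (rho : {multiplicative pi1orb R -> SO R 4}).

Local Notation adform := ('cV[R]_8 -> form 8 'M[R]_4).

(* Smooth sections of Lambda^k (x) Ad E_0: so(4)-valued k-forms on R^8 that are
   equivariant for the action g.(x, X) = (g x, Ad (rho g) X). The pull-back of
   theta to R^8 is the trivial connection, so that d_theta becomes ext_d. *)
Definition Ad_section (k : nat) : set adform :=
  [set w | [/\ smooth_form w,
               forall x, is_kform k (w x),
               forall x I, so_alg (w x I) &
               forall (g : pi1orb R) x,
                 pullback g w x = [ffun I => Ad (rho g) (w x I)]]].

Definition Ad_section27 : set adform :=
  [set w | Ad_section 2 w /\ forall x, Lambda27 (w x)].

Definition d1 (a : adform) : adform := fun x => pi27 (ext_d a x).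

Definition Z0 : set adform := [set f | Ad_section 0 f /\ ext_d f = cst 0].
Definition B0 : set adform := [set cst 0].
Definition Z1 : set adform := [set a | Ad_section 1 a /\ d1 a = cst 0].
Definition B1 : set adform := [set ext_d f | f in Ad_section 0].
Definition Z2 : set adform := Ad_section27.
Definition B2 : set adform := [set d1 a | a in Ad_section 1].

(* The cohomology Z / B vanishes. *)
Definition vanishing_cohomology (Z B : set adform) : Prop := Z `<=` B.

Definition irreducible : Prop := vanishing_cohomology Z0 B0.
Definition infinitesimally_rigid : Prop := vanishing_cohomology Z1 B1.
Definition unobstructed : Prop := vanishing_cohomology Z2 B2.

Definition valid_for_construction : Prop :=
  [/\ irreducible, infinitesimally_rigid & unobstructed].

End Deformation.

(* Main.v *)
Require Import Defs.
From HB Require Import structures.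
From mathcomp Require Import all_boot all_order all_algebra.
From mathcomp Require Import all_classical all_reals all_analysis.
From mathcomp Require Import ring lra zify.

Set Implicit Arguments.
Unset Strict Implicit.
Unset Printing Implicit Defensive.

Import Order.TTheory GRing.Theory Num.Theory.
Import numFieldNormedType.Exports.

Local Open Scope classical_set_scope.
Local Open Scope ring_scope.

(* Let V = so(4), on which the commuting involutions t_i = Ad (rho tau_i) act.
   The Klein four-group consists of diagonal matrices in a suitable basis and
   separates the four coordinate lines, so no nonzero vector of V is fixed by all
   the t_i. Hence a function u : R^8 -> V with u (x + e_i) = t_i u (x) splits
   into pieces each of which changes sign under some unit translation, and the
   flat Laplacian is invertible on smooth functions of this kind. The three
   cohomology groups then vanish for algebraic reasons: with A_1, ..., A_7 the
   octonionic basis of Lambda^2_7, the symbol of d_theta^* + pi_7 d_theta on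
   1-forms is, up to normalisation, a Clifford multiplication; so its composites
   with its adjoint are Laplacians, on 1-forms as well as on Lambda^2_7.

   Inverting the Laplacian needs no Fourier series. On functions f with
   f (x + e_k) = - f (x), period 2 in all directions, the finite difference
   Laplacian with step 1 / (2 N) satisfies |f| <= |Lap_N f| / 8 in sup norm.
   Jacobi iteration gives approximate solutions that are finite combinations of
   translates of the right-hand side; these commute with derivatives, so the
   estimate bounds all derivatives uniformly in N and an ultrafilter limit as
   N -> oo is a smooth solution. *)

(** What the Klein condition buys is a spectral gap. On periodic functions the flat Laplacian kills
    the constants; a function that changes sign under a unit translation has no constant part, and
    this becomes quantitative by comparing a centred difference with a parabola. The constant 8
    comes from the maximum 1/8 of t (1 - t) / 2 on [0, 1]. Group elements other than translations
    play no part in solving the equations. These are solved among functions equivariant under the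
    unit translations only; solutions there are unique, so they inherit every further symmetry of
    the right-hand side. Every linear part is a diagonal matrix of signs and acts on each dx_J by a
    scalar, so a form is treated one component at a time. Lambda^2_7 is reached through [w + hodge
    (wedge Omega0 w) = 4 *: octproj w] on 2-forms: the eigenvalues of w |-> [hodge (wedge Omega0 w)]
    are 3 and -1, and 4 is also the squared norm of each A_j. This identity and the Clifford
    relations have integer coefficients and are settled by finite computation. *)

Local Notation form := Defs.form.

(** * Smooth functions *)

Section Smooth.
Variables (R : realType) (m : nat).
Local Notation n := m.+1.
Local Notation E := 'cV[R]_n.
Implicit Types (V : normedModType R) (x y v : E) (i j : 'I_n).

Lemma smooth_differentiable V (f : E -> V) x : smooth f -> differentiable f x.
Proof. by move=> sf; exact: (sf [::]). Qed.

Lemma smooth_derivable V (f : E -> V) x v : smooth f -> derivable f x v.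
Proof. by move=> sf; apply/diff_derivable/smooth_differentiable. Qed.

Lemma smooth_partial V (f : E -> V) i : smooth f -> smooth (partial i f).
Proof. by move=> sf s x; have := sf (rcons s i) x; rewrite -cats1 foldr_cat. Qed.

Lemma smooth_foldr V (f : E -> V) s : smooth f -> smooth (foldr (partial (V:=V)) f s).
Proof. by move=> sf; elim: s => //= i s; exact: smooth_partial. Qed.

(** Coinduction: membership in [P] survives every word of partial derivatives. The closure
    properties below take for [P] the class of all functions of a given shape, so that no formula
    for iterated derivatives is needed. *)
Lemma smooth_coind V (P : (E -> V) -> Prop) :
  (forall f, P f -> (forall x, differentiable f x) /\ forall i, P (partial i f)) ->
  forall f, P f -> smooth f.
Proof.
move=> HP f Pf s; have /HP[] // : P (foldr (partial (V:=V)) f s).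
by elim: s => //= i s /HP[].
Qed.

Lemma partial_shift V (f : E -> V) v i :
  partial i (fun x => f (x + v)) = fun x => partial i f (x + v).
Proof.
apply: funext => x; rewrite /partial /derive.
apply: (f_equal (fun F : R -> V => lim (F @ 0^'))); apply/funext => h /=.
by rewrite addrA.
Qed.

Lemma derive_dir V (f : E -> V) x v : smooth f ->
  'D_v f x = \sum_i v i 0 *: partial i f x.
Proof.
move=> sf; rewrite deriveE; last exact: smooth_differentiable.
rewrite {1}[v]matrix_sum_delta linear_sum; apply: eq_bigr => i _.
rewrite big_ord1 linearZ /partial deriveE //; exact: smooth_differentiable.
Qed.

Lemma partialD V (f g : E -> V) i : smooth f -> smooth g ->
  partial i (fun x => f x + g x) = fun x => partial i f x + partial i g x.
Proof.
by move=> sf sg; apply/funext => x; rewrite /partial deriveD //; exact: smooth_derivable.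
Qed.

Lemma partialZ V (f : E -> V) (c : R) i : smooth f ->
  partial i (fun x => c *: f x) = fun x => c *: partial i f x.
Proof.
by move=> sf; apply/funext => x; rewrite /partial deriveZ //; exact: smooth_derivable.
Qed.

Lemma partial_cst V (c : V) i : partial i (fun _ : E => c) = fun=> 0.
Proof. by apply/funext => x; rewrite /partial derive_cst. Qed.

Lemma smooth_cst V (c : V) : smooth (fun _ : E => c).
Proof.
apply: (@smooth_coind _ (fun f => exists c, f = fun=> c)); last by exists c.
move=> _ [d ->]; split=> [x|i]; first exact: differentiable_cst.
by exists 0; rewrite partial_cst.
Qed.

Lemma smoothD V (f g : E -> V) : smooth f -> smooth g ->
  smooth (fun x => f x + g x).
Proof.
move=> sf sg.
apply: (@smooth_coind _ (fun h => exists f g,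
  [/\ smooth f, smooth g & h = fun x => f x + g x])); last by exists f, g.
move=> _ [a [b [sa sb ->]]]; split=> [x|i].
  by apply: differentiableD; exact: smooth_differentiable.
exists (partial i a), (partial i b).
by split; [exact: smooth_partial..|rewrite partialD].
Qed.

Lemma smoothZ V (f : E -> V) (c : R) : smooth f -> smooth (fun x => c *: f x).
Proof.
move=> sf.
apply: (@smooth_coind _ (fun h => exists2 f, smooth f & h = fun x => c *: f x));
  last by exists f.
move=> _ [a sa ->]; split=> [x|i].
  by apply: differentiableZ; exact: smooth_differentiable.
by exists (partial i a); [exact: smooth_partial|rewrite partialZ].
Qed.

Lemma smooth_sum V (I : Type) (r : seq I) (P : pred I) (f : I -> E -> V) :
  (forall k, P k -> smooth (f k)) -> smooth (fun x => \sum_(k <- r | P k) f k x).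
Proof.
move=> sf; elim: r => [|k r IH].
  by under eq_fun do rewrite big_nil; exact: smooth_cst.
under eq_fun do rewrite big_cons; case Pk: (P k) => //.
by apply: smoothD => //; exact: sf.
Qed.

Lemma partial_sum V (I : Type) (r : seq I) (P : pred I) (f : I -> E -> V) i :
  (forall k, P k -> smooth (f k)) ->
  partial i (fun x => \sum_(k <- r | P k) f k x) =
  fun x => \sum_(k <- r | P k) partial i (f k) x.
Proof.
move=> sf; elim: r => [|k r IH].
  under eq_fun do rewrite big_nil.
  by rewrite partial_cst; apply/funext => x; rewrite big_nil.
under eq_fun do rewrite big_cons; case Pk: (P k).
  rewrite partialD; [|exact: sf|exact: smooth_sum].
  by apply/funext => x; rewrite big_cons Pk IH.
by rewrite IH; apply/funext => x; rewrite big_cons Pk.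
Qed.

Lemma smoothN V (f : E -> V) : smooth f -> smooth (fun x => - f x).
Proof.
by move=> sf; under eq_fun do rewrite -scaleN1r; exact: smoothZ.
Qed.

Lemma partialN V (f : E -> V) i : smooth f ->
  partial i (fun x => - f x) = fun x => - partial i f x.
Proof.
move=> sf; under eq_fun do rewrite -scaleN1r.
by rewrite partialZ //; apply/funext => x; rewrite scaleN1r.
Qed.

Lemma smoothB V (f g : E -> V) : smooth f -> smooth g ->
  smooth (fun x => f x - g x).
Proof. by move=> sf sg; apply: smoothD => //; exact: smoothN. Qed.

Lemma partialB V (f g : E -> V) i : smooth f -> smooth g ->
  partial i (fun x => f x - g x) = fun x => partial i f x - partial i g x.
Proof. by move=> sf sg; rewrite partialD ?partialN //; exact: smoothN. Qed.

Lemma differentiable_affine (A : 'M[R]_n) (b x : E) :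
  differentiable (fun y : E => A *m y + b) x.
Proof.
have -> : (fun y : E => A *m y + b) =
    (\sum_j (fun y : E => y j 0 *: col j A)) + cst b.
  apply/funext => y; rewrite fctE fct_sumE; congr (_ + _).
  apply/matrixP => k l; rewrite !mxE summxE; apply: eq_bigr => j _.
  by rewrite !mxE (ord1 l) mulrC.
apply: differentiableD => //; apply: differentiable_sum => j.
by apply: differentiableZl; exact: differentiable_coord.
Qed.

Lemma derive_affine V (f : E -> V) (A : 'M[R]_n) (b x v : E) :
  'D_v (fun y => f (A *m y + b)) x = 'D_(A *m v) f (A *m x + b).
Proof.
rewrite /derive; apply: (f_equal (fun F : R -> V => lim (F @ 0^'))); apply/funext => h /=.
by rewrite mulmxDr scalemxAr addrA.
Qed.

Lemma partial_affine V (f : E -> V) (A : 'M[R]_n) (b : E) i : smooth f ->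
  partial i (fun y => f (A *m y + b)) =
  fun x => \sum_j A j i *: partial j f (A *m x + b).
Proof.
move=> sf; apply/funext => x; rewrite [LHS]derive_affine derive_dir //.
by apply: eq_bigr => j _; rewrite -colE mxE.
Qed.

Lemma smooth_affine V (f : E -> V) (A : 'M[R]_n) (b : E) : smooth f ->
  smooth (fun y => f (A *m y + b)).
Proof.
move=> sf.
apply: (@smooth_coind _ (fun h =>
  exists2 f, smooth f & h = fun y => f (A *m y + b))); last by exists f.
move=> _ [a sa ->]; split=> [x|i].
  apply: (@differentiable_comp _ _ _ _ (fun y : E => A *m y + b)).
    exact: differentiable_affine.
  exact: smooth_differentiable.
exists (fun x => \sum_j A j i *: partial j a x); last by rewrite partial_affine.
by apply: smooth_sum => j _; apply/smoothZ/smooth_partial.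
Qed.

Lemma smooth_shift V (f : E -> V) v : smooth f -> smooth (fun x => f (x + v)).
Proof.
by move=> sf; have := smooth_affine 1%:M v sf; under eq_fun do rewrite mul1mx.
Qed.

Lemma smooth_scaler V (f : E -> R) (v : V) : smooth f -> smooth (fun x => f x *: v).
Proof.
move=> sf.
apply: (@smooth_coind _ (fun h =>
  exists2 f : E -> R, smooth f & h = fun x => f x *: v)); last by exists f.
move=> _ [a sa ->]; split=> [x|i].
  by apply: differentiableZl; exact: smooth_differentiable.
exists (partial i a); first exact: smooth_partial.
apply/funext => x; rewrite /partial !deriveE;
  [|exact: smooth_differentiable|
    by apply: differentiableZl; exact: smooth_differentiable].
by rewrite diffZl //; exact: smooth_differentiable.
Qed.

Section Entries.
Variables (p q : nat).
Implicit Types (F : E -> 'M[R]_(p.+1, q.+1)).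

Lemma partial_entry F i a b : smooth F ->
  partial i (fun x => F x a b) = fun x => partial i F x a b.
Proof.
move=> sF; apply/funext => x; rewrite /partial.
have dF : derivable F x (delta_mx i 0) by exact: smooth_derivable.
apply: cvg_lim => //.
rewrite (_ : (fun h => _) =
  (fun M : 'M[R]_(p.+1, q.+1) => M a b) \o
  (fun h : R => h^-1 *: ((F \o shift x) (h *: delta_mx i 0) - F x))); last first.
  by apply/funext => h /=; rewrite !mxE.
apply: cvg_comp; [exact: dF|exact: coord_continuous].
Qed.

Lemma smooth_entry F a b : smooth F -> smooth (fun x => F x a b).
Proof.
move=> sF.
apply: (@smooth_coind _ (fun h : E -> R =>
  exists2 F : E -> 'M[R]_(p.+1, q.+1), smooth F & h = fun x => F x a b));
  last by exists F.
move=> _ [G sG ->]; split=> [x|i].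
  apply: (@differentiable_comp _ _ _ _ G (fun M : 'M[R]_(p.+1, q.+1) => M a b)).
    exact: smooth_differentiable.
  exact: differentiable_coord.
by exists (partial i G); [exact: smooth_partial|rewrite partial_entry].
Qed.

Lemma smooth_mx F : (forall a b, smooth (fun x => F x a b)) -> smooth F.
Proof.
move=> sF; rewrite (_ : F = fun x => \sum_a \sum_b F x a b *: delta_mx a b).
  by do 2![apply: smooth_sum => ? _]; exact: smooth_scaler.
by apply/funext => x; exact: matrix_sum_delta.
Qed.

End Entries.

End Smooth.

(** * Taylor estimates *)

Section Taylor.
Variables (R : realType) (m : nat).
Local Notation n := m.+1.
Local Notation E := 'cV[R]_n.
Local Notation e i := (delta_mx i 0 : E).
Implicit Types (f : E -> R) (x y v : E) (i j : 'I_n) (C h t : R).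

Lemma mean_value_bound (phi dphi : R -> R) h C :
  (forall t, is_derive t 1 phi (dphi t)) -> phi 0 = 0 -> 0 <= h ->
  (forall t, 0 <= t <= h -> `|dphi t| <= C) -> `|phi h| <= C * h.
Proof.
move=> dp p0 h0 bd.
have cp : {within `[0, h], continuous phi}.
  apply: derivable_within_continuous => t _.
  by have [] := dp t.
have [c] := MVT_segment h0 (fun t _ => dp t) cp.
rewrite p0 !subr0 in_itv /= => /bd bc ->.
by rewrite normrM (ger0_norm h0) ler_wpM2r.
Qed.

Lemma mx_entry_norm_le p q (A : 'M[R]_(p.+1, q.+1)) (i : 'I_p.+1)
  (j : 'I_q.+1) : `|A i j| <= `|A|.
Proof.
rewrite /Num.norm /= mx_normrE.
exact: (le_bigmax _ (fun k : 'I_p.+1 * 'I_q.+1 => `|A k.1 k.2|) (i, j)).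
Qed.

Lemma norm_delta_le i : `|e i| <= 1.
Proof.
rewrite /Num.norm /= mx_normrE; apply: bigmax_le => // -[k l] _ /=.
by rewrite mxE; case: (_ && _); rewrite ?normr1 // normr0.
Qed.

Lemma is_derive_line f x y t : smooth f ->
  is_derive t 1 (fun s => f (x + s *: y))
    (\sum_i y i 0 * partial i f (x + t *: y)).
Proof.
move=> sf; rewrite -[X in is_derive _ _ _ X](derive_dir (x + t *: y) y sf).
have E1 : (fun h => h^-1 *: (((fun s => f (x + s *: y)) \o shift t) (h *: 1)
      - f (x + t *: y))) =
    (fun h => h^-1 *: ((f \o shift (x + t *: y)) (h *: y) - f (x + t *: y))).
  apply/funext => h /=; congr (_ *: (f _ - _)).
  by rewrite -[h%:A]/(h * 1) mulr1 scalerDl addrCA.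
apply: DeriveDef; last by rewrite /derive E1.
by rewrite /derivable E1; exact: smooth_derivable.
Qed.

Lemma is_derive_axis f x i t : smooth f ->
  is_derive t 1 (fun s => f (x + s *: e i)) (partial i f (x + t *: e i)).
Proof.
move=> sf; apply: is_derive_eq; first exact: is_derive_line.
rewrite (bigD1 i) //= big1 ?addr0 => [|j ji].
  by rewrite mxE !eqxx mul1r.
by rewrite mxE (negPf ji) mul0r.
Qed.

Lemma is_derive_axisN f x i t : smooth f ->
  is_derive t 1 (fun s => f (x - s *: e i)) (- partial i f (x - t *: e i)).
Proof.
move=> sf; rewrite (_ : (fun s => _) = fun s => f (x + s *: (- e i))); last first.
  by apply/funext => s; rewrite scalerN.
apply: is_derive_eq; first exact: is_derive_line.
rewrite scalerN (bigD1 i) //= big1 ?addr0 => [|j ji].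
  by rewrite !mxE !eqxx mulN1r.
by rewrite !mxE (negPf ji) oppr0 mul0r.
Qed.

Lemma lipschitz_bound f C : smooth f -> (forall i x, `|partial i f x| <= C) ->
  forall x y, `|f (x + y) - f x| <= n%:R * C * `|y|.
Proof.
move=> sf bC x y.
have := @mean_value_bound (fun s => f (x + s *: y) - f x)
  (fun t => \sum_i y i 0 * partial i f (x + t *: y)) 1 (n%:R * C * `|y|).
rewrite scale1r mulr1; apply => //.
- move=> t; apply: is_derive_eq.
    by apply: is_deriveB; do ?[exact: is_derive_line|exact: is_derive_cst].
  by rewrite subr0.
- by rewrite scale0r addr0 subrr.
- move=> t _; apply: le_trans (ler_norm_sum _ _ _) _.
  apply: le_trans (_ : \sum_(i < n) `|y| * C <= _).
    apply: ler_sum => i _; rewrite normrM ler_pM //; exact: mx_entry_norm_le.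
  by rewrite sumr_const card_ord -mulrA mulr_natl (mulrC C).
Qed.

(** The remainder along the segment from [x] to [x + y] has a difference of gradients as derivative.
    One factor [n] comes from the sum over the gradient, the other from the Lipschitz bound for each
    of its entries. *)
Lemma taylor1_bound f C : smooth f ->
  (forall i j x, `|partial i (partial j f) x| <= C) ->
  forall x y, `|f (x + y) - f x - \sum_i y i 0 * partial i f x|
    <= n%:R ^+ 2 * C * `|y| ^+ 2.
Proof.
move=> sf bC x y.
have C0 : 0 <= C by apply: le_trans (bC ord0 ord0 0).
have := @mean_value_bound
  (fun s => f (x + s *: y) - f x - s * (\sum_i y i 0 * partial i f x))
  (fun t => \sum_i y i 0 * (partial i f (x + t *: y) - partial i f x)) 1
  (n%:R ^+ 2 * C * `|y| ^+ 2).
rewrite scale1r mulr1 mul1r; apply => //.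
- move=> t; apply: is_derive_eq.
    apply: is_deriveB.
      by apply: is_deriveB; do ?[exact: is_derive_line|exact: is_derive_cst].
  rewrite subr0 scaler0 add0r [_ *: 1]mulr1 -sumrB.
  by apply: eq_bigr => i _; rewrite mulrBr.
- by rewrite scale0r addr0 subrr mul0r subr0.
- move=> t /andP[t0 t1]; apply: le_trans (ler_norm_sum _ _ _) _.
  apply: le_trans (_ : \sum_(i < n) `|y| * (n%:R * C * `|y|) <= _).
    apply: ler_sum => i _; rewrite normrM ler_pM ?mx_entry_norm_le //.
    apply: le_trans (lipschitz_bound (smooth_partial i sf) (bC^~ i) _ _) _.
    by rewrite ler_wpM2l ?mulr_ge0 // normrZ ger0_norm // ler_piMl.
  rewrite sumr_const card_ord -[X in X <= _]mulr_natl le_eqVlt.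
  by apply/predU1P; left; ring.
Qed.

(** The mean value bound is applied twice in the step size: [psi] bounds the first derivative of the
    remainder, and the second derivative is a sum of two increments of [partial i (partial i f)].
    The order 3 suffices, since division by [h ^+ 2] still leaves a factor [h]. *)
Lemma second_difference_bound f i C : smooth f ->
  (forall j x, `|partial j (partial i (partial i f)) x| <= C) ->
  forall x h, 0 <= h ->
  `|f (x + h *: e i) + f (x - h *: e i) - 2 * f x
     - h ^+ 2 * partial i (partial i f) x| <= n%:R * C * 2 * h ^+ 3.
Proof.
move=> sf bC x h h0.
have C0 : 0 <= C by apply: le_trans (bC ord0 0).
have sp := smooth_partial i sf; have spp := smooth_partial i sp.
set D := partial i (partial i f) x.
have lip t (s : R) : 0 <= t <= h -> `|s| = 1 ->
    `|partial i (partial i f) (x + (s * t) *: e i) - D| <= n%:R * C * h.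
  move=> /andP[t0 th] s1; apply: le_trans (lipschitz_bound spp bC _ _) _.
  rewrite ler_wpM2l ?mulr_ge0 // normrZ normrM s1 mul1r ger0_norm //.
  apply: le_trans th; rewrite ler_piMr //; exact: norm_delta_le.
have psi t : 0 <= t <= h ->
    `|partial i f (x + t *: e i) - partial i f (x - t *: e i) - t * (2 * D)|
    <= n%:R * C * 2 * h * t.
  move=> /andP[t0 th]; apply: (@mean_value_bound
    (fun t => partial i f (x + t *: e i) - partial i f (x - t *: e i) - t * (2 * D))
    (fun t => partial i (partial i f) (x + t *: e i)
       + partial i (partial i f) (x - t *: e i) - 2 * D)) => //.
  - move=> s; apply: is_derive_eq.
      apply: is_deriveB.
        by apply: is_deriveB; do ?[exact: is_derive_axis|exact: is_derive_axisN].
    by rewrite opprK scaler0 add0r [_ *: 1]mulr1.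
  - by rewrite scale0r subr0 addr0 subrr mul0r subr0.
  - move=> s /andP[s0 st]; have sh : 0 <= s <= h by rewrite s0 (le_trans st).
    have := lip s 1 sh (normr1 _); have := lip s (-1) sh (normrN1 _).
    rewrite mul1r mulN1r scaleNr.
    set a := partial i _ _; set b := partial i _ (x + _) => ha hb.
    rewrite (_ : _ - _ = (b - D) + (a - D)); last by ring.
    apply: le_trans (ler_normD _ _) _.
    apply: le_trans (lerD hb ha) _.
    by rewrite -[X in X <= _]mulr2n -[X in X <= _]mulr_natr mulrAC.
have := @mean_value_bound
  (fun t => f (x + t *: e i) + f (x - t *: e i) - 2 * f x - t ^+ 2 * D)
  (fun t => partial i f (x + t *: e i) - partial i f (x - t *: e i) - t * (2 * D))
  h (n%:R * C * 2 * h * h).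
rewrite (_ : _ * h * h * h = n%:R * C * 2 * h ^+ 3); last by ring.
apply => //.
- move=> s; apply: is_derive_eq.
    apply: is_deriveB.
      apply: is_deriveB; do ?exact: is_derive_cst.
      by apply: is_deriveD; do ?[exact: is_derive_axis|exact: is_derive_axisN].
  by rewrite subr0 scaler0 add0r -[s%:A]/(s * 1) -[D *: _]/(D * _); ring.
- by rewrite scale0r subr0 addr0 expr2 mul0r; ring.
- move=> t /[dup] th /psi /le_trans; apply.
  by rewrite ler_wpM2l ?mulr_ge0 //; case/andP: th.
Qed.

Definition bounded_derivatives f :=
  forall s, exists C, forall x, `|foldr (partial (V:=R)) f s x| <= C.

Lemma le0_linear (a C : R) : (forall t, 0 < t -> a <= C * t) -> a <= 0.
Proof.
move=> H; apply/ler_addgt0Pr => d d0; rewrite add0r.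
have C1 : 0 < `|C| + 1 by rewrite ltr_wpDl.
have := H (d / (`|C| + 1)) (divr_gt0 d0 C1).
move/le_trans; apply; rewrite mulrCA ger_pMr // ler_pdivrMr // mul1r.
by apply: le_trans (ler_norm _) _; rewrite lerDl.
Qed.

Lemma derivatives_bound f (k : nat) : bounded_derivatives f ->
  exists C, forall s : k.-tuple 'I_n, forall x,
    `|foldr (partial (V:=R)) f s x| <= C.
Proof.
move=> /(_ _)/cid-/all_sig[C HC].
exists (\sum_(s : k.-tuple 'I_n) `|C s|) => s x.
apply: le_trans (HC s x) _; apply: le_trans (ler_norm _) _.
by rewrite (bigD1 s) //= lerDl sumr_ge0.
Qed.

(* The mixed second difference of f is symmetric in i and j. *)
Lemma partialC f i j : smooth f -> bounded_derivatives f ->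
  partial i (partial j f) = partial j (partial i f).
Proof.
move=> sf bf; apply/funext => x.
have [C HC] := derivatives_bound 3 bf.
have bC k l p y : `|partial k (partial l (partial p f)) y| <= C.
  exact: (HC [tuple k; l; p]).
have C0 : 0 <= C by apply: le_trans (bC ord0 ord0 ord0 0).
have key k l t : 0 < t ->
  `|f (x + t *: e k + t *: e l) - f (x + t *: e k) - (f (x + t *: e l) - f x)
    - t ^+ 2 * partial l (partial k f) x|
    <= (n%:R ^+ 2 * C + n%:R * C) * t ^+ 3.
  move=> t0; have sk := smooth_partial k sf; have slk := smooth_partial l sk.
  pose c := t * partial l (partial k f) x.
  (* The mixed difference is the increment over [0, t] of [f (x + t e_l + s e_k) - f (x + s e_k)] as
     a function of s. Its derivative is a first difference of [partial k f] in direction [l], to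
     which the Taylor bound applies. *)
  have := @mean_value_bound
    (fun s => f (x + t *: e l + s *: e k) - f (x + s *: e k)
       - (f (x + t *: e l) - f x) - s * c)
    (fun s => partial k f (x + t *: e l + s *: e k) - partial k f (x + s *: e k) - c)
    t ((n%:R ^+ 2 * C + n%:R * C) * t ^+ 2).
  rewrite (_ : t * c = t ^+ 2 * partial l (partial k f) x); last first.
    by rewrite /c; ring.
  rewrite (_ : _ * t ^+ 2 * t = (n%:R ^+ 2 * C + n%:R * C) * t ^+ 3); last by ring.
  rewrite [x + t *: e l + t *: e k]addrAC; apply; first 2 last.
  - exact: ltW.
  - move=> s /andP[s0 st].
    have T1 := taylor1_bound sk (fun a b => bC a b k) (x + s *: e k) (t *: e l).
    have L1 := lipschitz_bound slk (fun a => bC a l k) x (s *: e k).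
    move: T1; rewrite (bigD1 l) //= big1 ?addr0; last first.
      by move=> p pl; rewrite !mxE (negPf pl) mulr0 mul0r.
    rewrite !mxE !eqxx mulr1 [x + t *: _ + _]addrAC => T1.
    set A := partial k f _ in T1 *; set B := partial k f _ in T1 *.
    set D := partial l _ _ in T1 L1 *.
    rewrite (_ : A - B - c = (A - B - t * D) +
      t * (D - partial l (partial k f) x)); last by rewrite /c; ring.
    apply: le_trans (ler_normD _ _) _; rewrite mulrDl; apply: lerD.
      apply: le_trans T1 _; rewrite ler_wpM2l ?mulr_ge0 //.
      rewrite lerXn2r ?nnegrE ?normr_ge0 ?(ltW t0) //.
      by rewrite normrZ gtr0_norm // ler_piMr ?norm_delta_le // ltW.
    rewrite normrM gtr0_norm // expr2 mulrA [_ * t * t]mulrC ler_wpM2l ?(ltW t0) //.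
    apply: le_trans L1 _; rewrite ler_wpM2l ?mulr_ge0 // normrZ ger0_norm //.
    by apply: le_trans st; rewrite ler_piMr ?norm_delta_le.
  - move=> s; apply: is_derive_eq.
      apply: is_deriveB.
        apply: is_deriveB; do ?exact: is_derive_cst.
        by apply: is_deriveB; exact: is_derive_axis.
    by rewrite subr0 scaler0 add0r [_ *: 1]mulr1.
  - by rewrite !scale0r !addr0 mul0r; ring.
apply/eqP; rewrite -subr_eq0 -normr_eq0 eq_le normr_ge0 andbT.
(* In [key i j] and [key j i] the mixed difference is the same, so the two mixed derivatives differ
   by at most a multiple of t ^ 3 / t ^ 2, and t is arbitrary. *)
apply: (@le0_linear _ (2 * (n%:R ^+ 2 * C + n%:R * C))) => t t0.
have := key i j t t0; have := key j i t t0; rewrite [x + _ + t *: e i]addrAC.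
set K := _ + _ * C; set a := partial i _ _; set b := partial j _ _.
set f1 := f _; set f2 := f _; set f3 := f _ => H1 H2.
rewrite -(ler_pM2r (exprn_gt0 2 t0)).
rewrite -[X in _ * X <= _]ger0_norm ?exprn_ge0 ?(ltW t0) // -normrM.
rewrite (_ : (a - b) * _ = (f1 - f3 - (f2 - f x) - t ^+ 2 * b)
  - (f1 - f2 - (f3 - f x) - t ^+ 2 * a)); last by ring.
apply: le_trans (ler_normB _ _) _; apply: le_trans (lerD H2 H1) _.
by rewrite le_eqVlt; apply/predU1P; left; ring.
Qed.

End Taylor.

(** * The discrete Laplacian *)

Section DiscreteLaplacian.
Variables (R : realType) (m : nat).
Local Notation n := m.+1.
Local Notation E := 'cV[R]_n.
Local Notation e i := (delta_mx i 0 : E).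
Implicit Types (f u w : E -> R) (x y v : E) (i j k : 'I_n) (h eps B W : R).

Definition antiperiodic (V : zmodType) k (f : E -> V) :=
  (forall i x, f (x + 2%:R *: e i) = f x) /\ (forall x, f (x + e k) = - f x).

Definition nbr_sum h f x := \sum_i (f (x + h *: e i) + f (x - h *: e i)).

Definition discrete_lap h f x := (h ^+ 2)^-1 * (nbr_sum h f x - (2 * n)%:R * f x).

(** Meaningful only for bounded [f], as [sup] takes a default value on unbounded sets; this is why
    the estimates carry an a priori bound [B]. *)
Definition sup_norm f := sup (range (fun x => `|f x|)).

Lemma le_sup_norm f B x : (forall x, `|f x| <= B) -> `|f x| <= sup_norm f.
Proof.
move=> fB; apply: ub_le_sup; last by exists x.
by exists B => _ [y _ <-].
Qed.

Lemma sup_norm_le f B : (forall x, `|f x| <= B) -> sup_norm f <= B.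
Proof.
move=> fB; apply: ge_sup; first by exists `|f 0|, 0.
by move=> _ [y _ <-].
Qed.

(** The maximum principle for convex sequences. By [slope], the step after an index is at least the
    average step up to it; once [q] exceeds [q 0] it therefore keeps growing and cannot be
    nonpositive at [M]. *)
Lemma convex_seq_le0 (q : nat -> R) (M : nat) :
  (forall j : nat, 2 * q j.+1 <= q j + q j.+2) -> q 0 <= 0 -> q M <= 0 ->
  forall j : nat, (j <= M)%N -> q j <= 0.
Proof.
move=> cvx q0 qM j jM; rewrite leNgt; apply/negP => qj.
have slope (i : nat) : q i - q 0%N <= i%:R * (q i.+1 - q i).
  elim: i => [|i IH]; first by rewrite subrr mul0r.
  have c := cvx i; have i0 : 0 <= i%:R :> R by [].
  have : i%:R * (q i.+1 - q i) <= i%:R * (q i.+2 - q i.+1).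
    by rewrite ler_wpM2l //; lra.
  by rewrite -natr1 mulrDl mul1r => H; lra.
suff pos d : 0 < q (j + d)%N by have := pos (M - j)%N; rewrite subnKC //; lra.
elim: d => [|d IH]; first by rewrite addn0.
rewrite addnS; have s := slope (j + d)%N.
have jd : 0 <= (j + d)%:R :> R by [].
have : 0 < (j + d)%:R * (q (j + d).+1 - q (j + d)%N) by lra.
case: (ltrgtP 0 ((j + d)%:R : R)) jd => // [jd _|<- _]; last by rewrite mul0r ltxx.
by rewrite pmulr_rgt0 // => H; lra.
Qed.

(* The centred difference [v (x + j h e_k) - v (x - j h e_k)] vanishes for
   [j = 0] and for [j h = 1], and is [2 v] for [j h = 1/2]; its sup over [x] is
   discretely concave in [j] up to the error [2 h^2 W]. *)
Lemma discrete_apriori k f (N : nat) B W : antiperiodic k f ->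
  (forall x, `|f x| <= B) -> let h := (2 * N.+1)%:R^-1 in
  (forall x, `|discrete_lap h f x| <= W) -> forall x, `|f x| <= W / 8.
Proof.
move=> [f2 fk] fB h LW x.
have W0 : 0 <= W by apply: le_trans (LW 0).
have hN : (2 * N.+1)%:R * h = 1 by rewrite /h mulfV // pnatr_eq0.
have h0 : 0 < h by rewrite invr_gt0 ltr0n.
pose U (j : nat) y := f (y + (j%:R * h) *: e k) - f (y - (j%:R * h) *: e k).
have UB (j : nat) y : `|U j y| <= B + B by apply: le_trans (ler_normB _ _) _; exact: lerD.
pose M (j : nat) := sup_norm (U j).
have UM (j : nat) y : `|U j y| <= M j by exact: le_sup_norm (UB j).
have step (j : nat) : 2 * M j.+1 <= M j + M j.+2 + 2 * h ^+ 2 * W.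
  set a := (j.+1%:R * h) *: e k.
  (* The neighbours of [y + a] and [y - a] in direction [k] are paired crosswise, which turns a
     shift of [y] along [e k] into a shift of [j] at the same [y]. *)
  have key y : (2 * n)%:R * U j.+1 y = \sum_(i | i != k)
      (U j.+1 (y + h *: e i) + U j.+1 (y - h *: e i)) + (U j y + U j.+2 y)
      - h ^+ 2 * (discrete_lap h f (y + a) - discrete_lap h f (y - a)).
    rewrite -mulrBr mulVKf ?expf_neq0 ?lt0r_neq0 //.
    rewrite [nbr_sum _ _ (y + _)](bigD1 k) //= [nbr_sum _ _ (y - _)](bigD1 k) //=.
    rewrite (eq_bigr (fun i => (f (y + a + h *: e i) + f (y + a - h *: e i)) -
       (f (y - a + h *: e i) + f (y - a - h *: e i)))); last first.
      move=> i _; rewrite /U -/a !(addrAC y _ a) !(addrAC y _ (- a)).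
      by ring.
    rewrite sumrB /U -/a.
    have aS : a + h *: e k = (j.+2%:R * h) *: e k.
      by rewrite /a -scalerDl; congr (_ *: _); rewrite -!natr1; ring.
    have aP : a - h *: e k = (j%:R * h) *: e k.
      by rewrite /a -scalerBl; congr (_ *: _); rewrite -!natr1; ring.
    rewrite -[y + a + _]addrA aS -[y + a - _]addrA aP.
    have -> : y - a + h *: e k = y - (j%:R * h) *: e k 
      by rewrite -aP opprB addrA addrAC.
    have -> : y - a - h *: e k = y - (j.+2%:R * h) *: e k by rewrite -aS opprD addrA.
    by ring.
  (* After passing to the supremum, the [2 * m] terms from the directions other than [k] cancel
     against [2 * n] on the left and leave the factor 2 of [step]. *)
  have bnd y : `|U j.+1 y| <= ((2 * m)%:R * M j.+1 + (M j + M j.+2)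
      + h ^+ 2 * (W + W)) / (2 * n)%:R.
    rewrite ler_pdivlMr ?ltr0n // mulrC -[X in X * _ <= _]ger0_norm ?ler0n //.
    rewrite -normrM key; apply: le_trans (ler_normB _ _) _; apply: lerD; last first.
      rewrite normrM ger0_norm ?exprn_ge0 ?(ltW h0) // ler_wpM2l ?exprn_ge0 ?(ltW h0) //.
      by apply: le_trans (ler_normB _ _) _; exact: lerD.
    apply: le_trans (ler_normD _ _) _; apply: lerD; last first.
      by apply: le_trans (ler_normD _ _) _; exact: lerD.
    apply: le_trans (ler_norm_sum _ _ _) _.
    apply: le_trans (_ : \sum_(i | i != k) (M j.+1 + M j.+1) <= _).
      apply: ler_sum => i _; apply: le_trans (ler_normD _ _) _; exact: lerD.
    rewrite sumr_const (_ : #|_| = m) -?mulr2n -?mulrnA ?mulr_natl //.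
    by have := cardC1 k; rewrite card_ord.
  have := sup_norm_le bnd; rewrite -/(M j.+1) ler_pdivlMr ?ltr0n //.
  by rewrite !natrM -natr1; lra.
(* With t = j h the subtracted term is the parabola W t (1 - t). Its second difference -2 h^2 W
   absorbs the error in [step], so [q] is convex. *)
pose q (j : nat) := M j - W * h ^+ 2 * (j%:R * ((2 * N.+1)%:R - j%:R)).
have M0 (j : nat) : (forall y, U j y = 0) -> M j <= 0.
  by move=> Uj; apply: sup_norm_le => y; rewrite Uj normr0.
have qN : q N.+1 <= 0.
  apply: (@convex_seq_le0 q (2 * N.+1)); last by rewrite mul2n -addnn leq_addr.
  - by move=> j; have := step j; rewrite /q -!natr1; lra.
  - rewrite /q mul0r mulr0 subr0; apply: M0 => y.
    by rewrite /U mul0r scale0r addr0 subr0 subrr.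
  - rewrite /q subrr !mulr0 subr0; apply: M0 => y.
    rewrite /U hN scale1r; apply/eqP; rewrite subr_eq0; apply/eqP.
    rewrite -[in RHS](f2 k); congr f.
    by rewrite scaler_nat mulr2n addrA subrK.
have hN2 : N.+1%:R * h = 2^-1.
  by move: hN; rewrite natrM => hN; lra.
have : M N.+1 <= W / 4.
  move: qN; rewrite /q natrM => qN.
  have -> : W / 4 = W * (N.+1%:R * h) ^+ 2 by rewrite hN2 expr2; field.
  by rewrite exprMn expr2; move: qN; rewrite expr2; lra.
(* The centred difference at the midpoint of [x - e k] and [x] is f (x) - f (x - e_k) = 2 f (x),
   while the parabola has height W / 4 at t = 1/2. *)
have := UM N.+1 (x - 2^-1 *: e k); rewrite /U hN2 subrK.
rewrite -addrA -opprD -scalerDl (_ : 2^-1 + 2^-1 = 1 :> R); last by field.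
rewrite scale1r; have := fk (x - e k); rewrite subrK => ->.
set b := f _; rewrite -opprD -mulr2n !normrN normrMn mulr2n; lra.
Qed.

End DiscreteLaplacian.

(** * Approximate solutions by Jacobi iteration *)

Section ApproximateSolutions.
Variables (R : realType) (m : nat).
Local Notation n := m.+1.
Local Notation E := 'cV[R]_n.
Local Notation e i := (delta_mx i 0 : E).
Implicit Types (f u w : E -> R) (x y v : E) (i j k : 'I_n) (h eps B W : R).

Lemma nbr_sum_shift h f v : nbr_sum h (fun x => f (x + v)) =
  fun x => nbr_sum h f (x + v).
Proof.
apply/funext => x; apply: eq_bigr => i _.
by rewrite ![x + v + _]addrAC.
Qed.

Lemma nbr_sumN h f : nbr_sum h (fun x => - f x) = fun x => - nbr_sum h f x.
Proof.
apply/funext => x; rewrite /nbr_sum -sumrN; apply: eq_bigr => i _.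
by rewrite opprD.
Qed.

Lemma smooth_nbr_sum h f : smooth f -> smooth (nbr_sum h f).
Proof.
by move=> sf; apply: smooth_sum => i _; apply: smoothD; exact: smooth_shift.
Qed.

Lemma partial_nbr_sum h f i : smooth f ->
  partial i (nbr_sum h f) = nbr_sum h (partial i f).
Proof.
move=> sf; rewrite partial_sum => [|j _]; last first.
  by apply: smoothD; exact: smooth_shift.
apply/funext => x; apply: eq_bigr => j _.
by rewrite partialD ?partial_shift //; exact: smooth_shift.
Qed.

Lemma nbr_sum_diff_bound h f g B : (forall x, `|f x - g x| <= B) ->
  forall x, `|nbr_sum h f x - nbr_sum h g x| <= (2 * n)%:R * B.
Proof.
move=> fB x; rewrite -sumrB; apply: le_trans (ler_norm_sum _ _ _) _.
apply: le_trans (_ : \sum_(i < n) (B + B) <= _).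
  apply: ler_sum => i _; rewrite opprD addrACA.
  by apply: le_trans (ler_normD _ _) _; exact: lerD.
by rewrite sumr_const card_ord -mulr2n -mulrnA mulr_natl.
Qed.

(* Jacobi iteration for [eps u - discrete_lap h u = w] *)
Fixpoint jacobi h eps w (J : nat) : E -> R :=
  if J is J'.+1 then fun x => (eps + (h ^+ 2)^-1 * (2 * n)%:R)^-1 *
    (w x + (h ^+ 2)^-1 * nbr_sum h (jacobi h eps w J') x)
  else fun=> 0.

Lemma jacobi_shift h eps w v J : jacobi h eps (fun x => w (x + v)) J =
  fun x => jacobi h eps w J (x + v).
Proof. by elim: J => //= J ->; rewrite nbr_sum_shift. Qed.

Lemma jacobiN h eps w J :
  jacobi h eps (fun x => - w x) J = fun x => - jacobi h eps w J x.
Proof.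
elim: J => [|J /= ->]; first by apply/funext => x; rewrite oppr0.
by apply/funext => x; rewrite nbr_sumN; ring.
Qed.

Lemma smooth_jacobi h eps w J : smooth w -> smooth (jacobi h eps w J).
Proof.
move=> sw; elim: J => [|J IH] /=; first exact: smooth_cst.
by apply: smoothZ; apply: smoothD => //; apply: smoothZ; exact: smooth_nbr_sum.
Qed.

Lemma partial_jacobi h eps w J i : smooth w ->
  partial i (jacobi h eps w J) = jacobi h eps (partial i w) J.
Proof.
move=> sw; elim: J => [|J IH] /=; first by rewrite partial_cst.
have sJ := smooth_nbr_sum h (smooth_jacobi h eps J sw).
rewrite partialZ; last by apply: smoothD => //; exact: smoothZ.
rewrite partialD ?partialZ ?partial_nbr_sum ?IH //; last exact: smoothZ.
exact: smooth_jacobi.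
Qed.

Lemma antiperiodic_jacobi k h eps w J : antiperiodic k w ->
  antiperiodic k (jacobi h eps w J).
Proof.
move=> [w2 wk]; split=> [i x|x].
  have := congr1 (fun f => f x) (jacobi_shift h eps w (2%:R *: e i) J).
  by move=> /= <-; under eq_fun do rewrite w2.
have := congr1 (fun f => f x) (jacobi_shift h eps w (e k) J).
by move=> /= <-; under eq_fun do rewrite wk; rewrite jacobiN.
Qed.

Section Estimates.
Variables (h eps : R).
Hypotheses (h0 : 0 < h) (eps0 : 0 < eps).
Let kap := (h ^+ 2)^-1.
Let c := (eps + kap * (2 * n)%:R)^-1.
Let q := kap * (2 * n)%:R * c.

Let kap0 : 0 < kap. Proof. by rewrite invr_gt0 exprn_gt0. Qed.
Let kn0 : 0 < kap * (2 * n)%:R. Proof. by rewrite mulr_gt0 // ltr0n. Qed.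
Let c0 : 0 < c. Proof. by rewrite invr_gt0 addr_gt0. Qed.

(** The term [eps] makes the iteration contract: for [eps = 0] the ratio would be 1. *)
Lemma jacobi_ratio : 0 <= q < 1.
Proof.
rewrite mulr_ge0 ?ltW //= /q /c ltr_pdivrMr ?addr_gt0 // mul1r.
by rewrite ltrDr.
Qed.

Lemma jacobi_increment w W J : (forall x, `|w x| <= W) ->
  forall x, `|jacobi h eps w J.+1 x - jacobi h eps w J x| <= c * q ^+ J * W.
Proof.
move=> wW; elim: J => [|J IH] x.
  rewrite /= subr0 /nbr_sum big1 => [|i _]; last by rewrite addr0.
  by rewrite mulr0 addr0 normrM (gtr0_norm c0) expr0 mulr1 ler_wpM2l // ltW.
have -> : jacobi h eps w J.+2 x - jacobi h eps w J.+1 x = c * (kap *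
    (nbr_sum h (jacobi h eps w J.+1) x - nbr_sum h (jacobi h eps w J) x)).
  by rewrite /= -/kap -/c; ring.
rewrite normrM (gtr0_norm c0) normrM (gtr0_norm kap0) -!mulrA (ler_pM2l c0).
have := nbr_sum_diff_bound h IH x; rewrite -(ler_pM2l kap0 (`|_|)) => /le_trans; apply.
by rewrite exprS /q le_eqVlt; apply/predU1P; left; ring.
Qed.

Lemma jacobi_bounded w W J : (forall x, `|w x| <= W) ->
  exists B, forall x, `|jacobi h eps w J x| <= B.
Proof.
move=> wW; elim: J => [|J [B HB]]; first by exists 0 => x; rewrite normr0.
exists (B + c * q ^+ J * W) => x.
rewrite -(subrK (jacobi h eps w J x) (jacobi h eps w J.+1 x)) addrC.
apply: le_trans (ler_normD _ _) _; apply: lerD => //.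
exact: jacobi_increment.
Qed.

(** A Jacobi step adds the residual divided by the diagonal entry [c^-1]; the residual is thus
    [c^-1] times the next increment and decays geometrically. *)
Lemma jacobi_residual w W J : (forall x, `|w x| <= W) -> forall x,
  `|discrete_lap h (jacobi h eps w J) x + w x - eps * jacobi h eps w J x|
    <= q ^+ J * W.
Proof.
move=> wW x; have := jacobi_increment J wW x.
have -> : discrete_lap h (jacobi h eps w J) x + w x - eps * jacobi h eps w J x =
    c^-1 * (jacobi h eps w J.+1 x - jacobi h eps w J x).
  rewrite /= -/kap -/c mulrBr mulKf ?lt0r_neq0 // /discrete_lap -/kap /c invrK.
  by ring.
have ci0 : 0 < c^-1 by rewrite invr_gt0.
by rewrite normrM (gtr0_norm ci0) ler_pdivrMl // mulrA.
Qed.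

End Estimates.

(** [J] is chosen before [w], so one and the same combination of translates serves for [w] and for
    all its derivatives. The regularisation [eps] is of order 1 / N and disappears in the limit. In
    the sign convention of [jacobi], [u] approximates a solution of lap u = - w. *)
Lemma approximate_solution (N : nat) : exists J, forall k w W,
  antiperiodic k w -> (forall x, `|w x| <= W) ->
  let u := jacobi (2 * N.+1)%:R^-1 N.+1%:R^-1 w J in
  forall x, `|u x| <= W /\ `|discrete_lap (2 * N.+1)%:R^-1 u x + w x| <= 2 * W / N.+1%:R.
Proof.
set h := (2 * N.+1)%:R^-1; set eps := N.+1%:R^-1.
have h0 : 0 < h by rewrite invr_gt0 ltr0n.
have eps0 : 0 < eps by rewrite invr_gt0 ltr0n.
have eps1 : eps <= 1 by rewrite invf_le1 ?ltr0n // ler1n.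
have := jacobi_ratio h0 eps0; set q := _ * _ * _ => /andP[q0 q1].
have [J qJ] : exists J, q ^+ J <= eps.
  have /cvgr0Pnorm_le/(_ eps eps0)[J _ /(_ J (leqnn J))] : q ^+ J @[J --> \oo] --> 0.
    by apply: cvg_expr; rewrite ger0_norm.
  by rewrite /= ger0_norm ?exprn_ge0 // => H; exists J.
exists J => k w W wk wW u.
have W0 : 0 <= W by apply: le_trans (wW 0).
have [B uB] := jacobi_bounded h0 eps0 J wW.
have res x : `|discrete_lap h u x + w x - eps * u x| <= eps * W.
  by apply: le_trans (jacobi_residual h0 eps0 J wW x) _; rewrite ler_wpM2r.
have epsW : eps * W <= W by rewrite ler_piMl.
pose S := sup_norm u.
have uS x : `|u x| <= S by exact: le_sup_norm uB.
have epsS x : `|eps * u x| <= eps * S.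
  by rewrite normrM gtr0_norm // ler_wpM2l // ltW.
have lapS x : `|discrete_lap h u x| <= S + 2 * W.
  have -> : discrete_lap h u x =
    (discrete_lap h u x + w x - eps * u x) + eps * u x - w x by ring.
  apply: le_trans (ler_normB _ _) _.
  apply: le_trans (lerD (ler_normD _ _) (wW x)) _.
  have S0 : 0 <= S by apply: le_trans (uS 0).
  have := lerD (lerD (res x) (epsS x)) (lexx W).
  have : eps * S <= S by rewrite ler_piMl.
  lra.
(* A bootstrap: the discrete Laplacian is bounded by [S + 2 * W] in terms of [S] itself, and the a
   priori estimate gives S <= (S + 2 W) / 8, hence S <= W. *)
have uS8 := discrete_apriori (antiperiodic_jacobi h eps J wk) uB lapS.
have SW : S <= W by have := sup_norm_le uS8; rewrite -/S; lra.
move=> x; split; first exact: le_trans SW.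
rewrite -(subrK (eps * u x) (_ + w x)).
apply: le_trans (ler_normD _ _) _.
have := lerD (res x) (epsS x); have : eps * S <= eps * W by rewrite ler_wpM2l // ltW.
by rewrite -/eps; lra.
Qed.

End ApproximateSolutions.

(** * Boundedness of periodic functions *)

Section Periodic.
Variables (R : realType) (m : nat).
Local Notation n := m.+1.
Local Notation E := 'cV[R]_n.
Local Notation e i := (delta_mx i 0 : E).
Implicit Types (f : E -> R) (x y : E) (i k : 'I_n).

(** Connects [EVT_max_rV], which concerns row vectors, with functions of column vectors. *)
Lemma differentiable_trmx (x : 'rV[R]_n) :
  differentiable (fun v : 'rV[R]_n => v^T : E) x.
Proof.
have -> : (fun v : 'rV[R]_n => v^T : E) = \sum_j (fun v : 'rV[R]_n => v 0 j *: e j).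
  apply/funext => v; rewrite fct_sumE; apply/matrixP => i l.
  rewrite summxE (bigD1 i) //= big1 => [|j ji].
    by rewrite !mxE (ord1 l) !eqxx addr0 mulr1.
  by rewrite !mxE eq_sym (negPf ji) mulr0.
apply: differentiable_sum => j; apply: differentiableZl.
exact: differentiable_coord.
Qed.

Lemma periodic_shift f : (forall i x, f (x + 2%:R *: e i) = f x) ->
  forall (z : 'I_n -> int) x, f (x + \sum_i (2 * z i)%:~R *: e i) = f x.
Proof.
move=> f2 z x; have step i y (a : int) : f (y + (2 * a)%:~R *: e i) = f y.
  have pos (b : nat) y' : f (y' + (2 * b%:Z)%:~R *: e i) = f y'.
    elim: b y' => [|b IH] y'; first by rewrite mulr0 scale0r addr0.
    by rewrite intS mulrDr mulr1 intrD scalerDl addrA IH f2.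
  case: a => b; first exact: pos.
  rewrite NegzE mulrN mulrNz scaleNr -[in RHS](subrK ((2 * b.+1%:Z)%:~R *: e i) y).
  by rewrite pos.
elim: (index_enum _) x => [|i r IH] x; first by rewrite big_nil addr0.
by rewrite big_cons addrA IH step.
Qed.

Lemma periodic_bounded f : (forall i x, f (x + 2%:R *: e i) = f x) ->
  continuous f -> exists B, forall x, `|f x| <= B.
Proof.
move=> f2 cf.
pose A := [set v : 'rV[R]_n | forall i, `[(0 : R), 2]%classic (v ord0 i)].
have cA : compact A.
  by apply: (@rV_compact R _ (fun=> `[0, 2]%classic)) => i; exact: segment_compact.
have A0 : A !=set0 by exists 0 => i /=; rewrite mxE in_itv /= lexx ler0n.
have cg : {within A, continuous (fun v : 'rV[R]_n => `|f v^T|)}.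
  apply: continuous_subspaceT => v.
  apply: (@continuous_comp _ _ _ (fun v : 'rV[R]_n => f v^T) (fun r : R => `|r|)).
    apply: (@continuous_comp _ _ _ (fun v : 'rV[R]_n => v^T : E) f).
      exact/differentiable_continuous/differentiable_trmx.
    exact: cf.
  exact: norm_continuous.
have [c _ cmax] := EVT_max_rV A0 cA cg.
exists `|f c^T| => x.
(* Translation by 2 z moves [x] into the cube [0, 2]^n. *)
pose z i : int := - Num.floor (x i 0 / 2).
rewrite -(periodic_shift f2 z x); set y := (_ + _).
have := cmax y^T; rewrite trmxK; apply; rewrite inE => i /=.
rewrite !mxE summxE (bigD1 i) //= big1 => [|j ji]; last first.
  by rewrite !mxE eq_sym (negPf ji) mulr0.
rewrite !mxE !eqxx mulr1 addr0 in_itv /=.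
have := floor_itv (x i 0 / 2); rewrite /z => /andP[].
rewrite intrM rmorphN /= intrD; set fl := _%:~R; lra.
Qed.

Lemma antiperiodic_partial k i f : smooth f -> antiperiodic k f ->
  antiperiodic k (partial i f).
Proof.
move=> sf [f2 fk]; split=> [j x|x].
  have := congr1 (fun g => g x) (partial_shift f (2%:R *: e j) i).
  by move=> /= <-; under eq_fun do rewrite f2.
have := congr1 (fun g => g x) (partial_shift f (e k) i).
by move=> /= <-; under eq_fun do rewrite fk; rewrite partialN.
Qed.

Lemma antiperiodic_foldr k s f : smooth f -> antiperiodic k f ->
  antiperiodic k (foldr (partial (V:=R)) f s).
Proof.
move=> sf fk; elim: s => //= i s IH.
by apply: antiperiodic_partial => //; exact: smooth_foldr.
Qed.

Lemma periodic_bounded_derivatives f : smooth f ->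
  (forall i x, f (x + 2%:R *: e i) = f x) -> bounded_derivatives f.
Proof.
move=> sf f2 s; apply: periodic_bounded => [i x|x].
  elim: s x => //= j s IH x.
  have := congr1 (fun g => g x)
    (partial_shift (foldr (partial (V:=R)) f s) (2%:R *: e i) j).
  by move=> /= <-; under eq_fun do rewrite IH.
exact/differentiable_continuous/smooth_differentiable/smooth_foldr.
Qed.

End Periodic.

(** * The Poisson equation *)

Section UltrafilterLimit.
Variables (R : realType) (U : set_system nat).
Hypotheses (ultraU : UltraFilter U) (infU : \oo `<=` U).
Implicit Types (a b : nat -> R) (B C l : R).

Lemma ultra_fmap (T : Type) (a : nat -> T) : UltraFilter (a @ U).
Proof.
split; first exact: fmap_proper_filter.
move=> G PG aG; apply/seteqP; split=> // A GA.
have [//|UA] := in_ultra_setVsetC (a @^-1` A) ultraU.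
have GAc : G (~` A) by exact: aG.
have : G (A `&` ~` A) by exact: filterI.
by rewrite setICr => /filter_not_empty.
Qed.

Lemma bounded_ultra_cvg a B : (forall N, `|a N| <= B) -> cvg (a @ U).
Proof.
move=> aB; have := @segment_compact R (- B) B; rewrite compact_ultra.
move=> /(_ (a @ U) (ultra_fmap a)) []; last by move=> l [_ al]; apply: cvgP al.
have UB : \forall N \near U, `[- B, B]%classic (a N).
  by apply: nearW => N; rewrite /= in_itv /= -ler_norml.
exact: UB.
Qed.

Definition ulim a := lim (a @ U).

Lemma ulimP a B : (forall N, `|a N| <= B) -> a @ U --> ulim a.
Proof. exact: bounded_ultra_cvg. Qed.

Lemma ulim_norm_le a B l : a @ U --> l -> (forall N, `|a N| <= B) -> `|l| <= B.
Proof.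
move=> al aB; have nal : (fun N => `|a N|) @ U --> `|l| by exact: cvg_norm.
rewrite -(cvg_lim _ nal) //; apply: limr_le; first exact: cvgP nal.
exact: nearW.
Qed.

Lemma ulim0 a C l : a @ U --> l -> (forall N, `|a N| <= C / N.+1%:R) -> l = 0.
Proof.
move=> al aC; have : a @ \oo --> (0 : R).
  apply: norm_cvg0; apply: (@squeeze_cvgr _ _ _ _ (fun=> 0) (fun N => C * harmonic N)).
  - by apply: nearW => N; rewrite normr_ge0; exact: aC.
  - exact: cvg_cst.
  - by rewrite -[X in _ --> X](mulr0 C); apply: cvgMr; exact: cvg_harmonic.
move=> a0; apply: (cvg_unique _ al) => //.
by apply: cvg_trans a0 => A; exact: infU.
Qed.

End UltrafilterLimit.

(** * Passage to the limit *)

Section Poisson.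
Variables (R : realType) (m : nat).
Local Notation n := m.+1.
Local Notation E := 'cV[R]_n.
Local Notation e i := (delta_mx i 0 : E).
Implicit Types (f g u w : E -> R) (x y : E) (i k : 'I_n).

(** A pointwise limit preserves inequalities only. A quadratic bound on the Taylor remainder is such
    an inequality, and it yields differentiability together with the gradient. *)
Lemma quadratic_differentiable g x (l : 'I_n -> R) (C : R) :
  (forall y, `|g (x + y) - g x - \sum_i y i 0 * l i| <= C * `|y| ^+ 2) ->
  differentiable g x /\ forall i, partial i g x = l i.
Proof.
move=> H.
have C0 : 0 <= C.
  have /(le_trans (normr_ge0 _)) := H (const_mx 1).
  rewrite pmulr_lge0 // exprn_gt0 // normr_gt0; apply/eqP => /matrixP/(_ 0 0).
  by rewrite !mxE => /eqP; rewrite oner_eq0.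
pose df0 y := \sum_i y i 0 * l i.
have df_lin : linear df0.
  move=> a y z; rewrite /df0 scaler_sumr -big_split; apply: eq_bigr => i _ /=.
  by rewrite !mxE mulrDl -mulrA.
pose dfM := GRing.isLinear.Build _ _ _ _ _ df_lin.
pose df : {linear E -> R} := HB.pack df0 dfM.
have cdf : continuous df.
  move=> y; apply: differentiable_continuous.
  have -> : (df : E -> R) = \sum_i (fun z : E => z i 0 *: (l i : R)).
    by apply/funext => z; rewrite fct_sumE.
  apply: differentiable_sum => i; apply: differentiableZl.
  exact: differentiable_coord.
have ex d : 0 < d ->
    \forall y \near (0 : E), `|g (y + x) - (g x + df0 y)| <= d * `|y|.
  move=> d0; have C10 : 0 < C + 1 by rewrite ltr_wpDl.
  have small : \forall y \near (0 : E), `|y| <= d / (C + 1).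
    by apply: nbhs0_le; rewrite divr_gt0.
  near=> y; rewrite opprD addrA [y + x]addrC.
  apply: le_trans (H y) _; rewrite expr2 mulrA ler_wpM2r //.
  have : `|y| <= d / (C + 1).
    by near: y.
  rewrite ler_pdivlMr // => /(le_trans _); apply.
  by rewrite mulrC ler_wpM2l // lerDl.
have dE : 'd g x = df :> (E -> R).
  by apply: diff_unique => //; apply/eqaddoP; exact: ex.
have dg : differentiable g x.
  apply/diff_locallyP; rewrite dE; split=> //.
  by apply/eqaddoP; exact: ex.
split=> // i; rewrite /partial deriveE // dE /= /df0 (bigD1 i) //= big1 => [|j ji].
  by rewrite mxE !eqxx mul1r addr0.
by rewrite mxE (negPf ji) mul0r.
Unshelve. all: by end_near. Qed.

Definition lap (V : normedModType R) (f : E -> V) x := \sum_i partial i (partial i f) x.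

Lemma discrete_lap_bound f C : smooth f ->
  (forall j i x, `|partial j (partial i (partial i f)) x| <= C) ->
  forall x h, 0 < h ->
  `|discrete_lap h f x - lap f x| <= n%:R * (n%:R * C * 2) * h.
Proof.
move=> sf bC x h h0; have hn : h ^+ 2 != 0 by rewrite expf_neq0 ?lt0r_neq0.
have -> : discrete_lap h f x - lap f x = \sum_i (h ^+ 2)^-1 *
    (f (x + h *: e i) + f (x - h *: e i) - 2 * f x
     - h ^+ 2 * partial i (partial i f) x).
  under eq_bigr do rewrite mulrBr mulKf //.
  rewrite sumrB -mulr_sumr sumrB sumr_const card_ord /discrete_lap.
  congr (_ * (_ - _) - _).
  by rewrite natrM -mulr_natl; ring.
apply: le_trans (ler_norm_sum _ _ _) _.
apply: le_trans (_ : \sum_(i < n) (n%:R * C * 2 * h) <= _); last first.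
  by rewrite sumr_const card_ord -[X in X <= _]mulr_natl mulrA.
apply: ler_sum => i _; rewrite normrM gtr0_norm ?invr_gt0 ?exprn_gt0 //.
rewrite ler_pdivrMl ?exprn_gt0 //.
apply: le_trans (second_difference_bound sf (fun j => bC j i) x (ltW h0)) _.
by rewrite le_eqVlt; apply/predU1P; left; ring.
Qed.

(** The discrete Laplacian of a harmonic [u] is of order h, so by the a priori estimate [u] itself
    is of order h for every step h = 1 / (2 (N + 1)). The 16 in [K] is 8 from that estimate times 2
    from the step. *)
Lemma antiperiodic_harmonic_eq0 k u : smooth u -> antiperiodic k u ->
  lap u = (fun=> 0) -> u = fun=> 0.
Proof.
move=> su uk Lu; have bu := periodic_bounded_derivatives su uk.1.
have [C HC] := derivatives_bound 3 bu.
have [B HB] := bu [::].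
apply/funext => x; apply/eqP; rewrite -normr_eq0 eq_le normr_ge0 andbT.
pose K := n%:R * (n%:R * C * 2) / 16.
have bx (N : nat) : `|u x| <= K / N.+1%:R.
  have h0 : 0 < (2 * N.+1)%:R^-1 :> R by rewrite invr_gt0 ltr0n.
  have := @discrete_apriori _ _ k u N B _ uk HB _ x.
  move=> /(_ (n%:R * (n%:R * C * 2) * (2 * N.+1)%:R^-1)) H.
  apply: le_trans (H _) _ => [y|].
    rewrite -[discrete_lap _ _ _]subr0 -[0](congr1 (fun f => f y) Lu).
    apply: discrete_lap_bound => // j i z.
    exact: (HC [tuple j; i; i]).
  rewrite /K natrM invfM le_eqVlt; apply/predU1P; left.
  by field; rewrite nat1r pnatr_eq0.
have K0 : 0 <= K by have := le_trans (normr_ge0 _) (bx 0%N); rewrite divr1.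
apply/ler_addgt0Pr => d d0; rewrite add0r.
have [N HN] : exists N : nat, K / N.+1%:R <= d.
  exists (Num.trunc (K / d)); rewrite ler_pdivrMr ?ltr0n // mulrC -ler_pdivrMr //.
  by apply/ltW/truncnS_gt.
exact: le_trans (bx N) HN.
Qed.

Theorem antiperiodic_poisson k w : smooth w -> antiperiodic k w ->
  exists u, [/\ smooth u, antiperiodic k u & lap u = w].
Proof.
move=> sw wk.
have [J HJ] : {J : nat -> nat | forall N k w W,
  antiperiodic k w -> (forall x, `|w x| <= W) ->
  let u := jacobi (2 * N.+1)%:R^-1 N.+1%:R^-1 w (J N) in
  forall x, `|u x| <= W /\
    `|discrete_lap (2 * N.+1)%:R^-1 u x + w x| <= 2 * W / N.+1%:R}.
  have H N := cid (@approximate_solution R m N).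
  by exists (fun N => sval (H N)) => N; exact: svalP (H N).
(* A single ultrafilter gives convergence of all bounded sequences at once, hence at all points and
   for all derivatives, without diagonal subsequences. *)
have [U [ultraU infU]] := ultraFilterLemma (@eventually_filter).
pose D s := foldr (partial (V:=R)) w s.
have sD s : smooth (D s) by exact: smooth_foldr.
have Dk s : antiperiodic k (D s) by exact: antiperiodic_foldr.
pose G N f := jacobi (2 * N.+1)%:R^-1 N.+1%:R^-1 f (J N) : E -> R.
(* Each candidate derivative is a limit in its own right: the same approximations applied to the
   derivative [D s] of [w]. That [v (i :: s)] differentiates [v s] is shown next. *)
pose v s x := ulim U (fun N => G N (D s) x).
have bw := periodic_bounded_derivatives sw wk.1.
have [W HW] : {W | forall s x, `|D s x| <= W s}.
  by have H s := cid (bw s); exists (fun s => sval (H s)) => s; exact: svalP (H s).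
have GW s N x : `|G N (D s) x| <= W s by have [] := HJ N k _ _ (Dk s) (HW s) x.
have GD s i N : partial i (G N (D s)) = G N (D (i :: s)).
  by rewrite /G partial_jacobi.
have Gv s x : G ^~ (D s) ^~ x @ U --> v s x by exact: (ulimP _ (GW s ^~ x)).
(* The Taylor bound for the approximations has a constant independent of [N], so it passes to the
   limit. *)
have dv s x : differentiable (v s) x /\ forall i, partial i (v s) x = v (i :: s) x.
  pose C := \sum_i \sum_j `|W [:: i, j & s]|.
  apply: (@quadratic_differentiable _ _ _ (n%:R ^+ 2 * C)) => y.
  apply: (@ulim_norm_le _ U _
    (fun N => G N (D s) (x + y) - G N (D s) x - \sum_i y i 0 * G N (D (i :: s)) x)).
    apply: cvgB; first by apply: cvgB; exact: Gv.
    by apply: (cvg_big add_continuous) => i _; apply: cvgMl_tmp; exact: Gv.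
  move=> N; under [\sum_i _]eq_bigr do rewrite -GD.
  apply: taylor1_bound; first exact: smooth_jacobi.
  move=> i j z; rewrite !GD; apply: le_trans (GW _ _ _) _.
  apply: le_trans (ler_norm _) _.
  rewrite /C (bigD1 i) //= (bigD1 j) //= -addrA lerDl.
  by rewrite addr_ge0 ?sumr_ge0 // => *; rewrite ?sumr_ge0.
have dvE s i : partial i (v s) = v (i :: s).
  by apply/funext => x; have [_] := dv s x; exact.
have sv : smooth (v [::]).
  move=> s; have -> : foldr (partial (V:=R)) (v [::]) s = v s.
    by elim: s => //= i s ->; exact: dvE.
  by move=> x; have [] := dv s x.
have vk : antiperiodic k (v [::]).
  split=> [i x|x].
    congr (ulim U _); apply/funext => N.
    by have [H _] := antiperiodic_jacobi (2 * N.+1)%:R^-1 N.+1%:R^-1 (J N) wk; exact: H.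
  apply: (@cvg_unique _ _ (G ^~ (D [::]) ^~ (x + e k) @ U)) => //; first exact: Gv.
  have -> : G ^~ (D [::]) ^~ (x + e k) = (fun N => - G N (D [::]) x).
    apply/funext => N.
    by have [_ H] := antiperiodic_jacobi (2 * N.+1)%:R^-1 N.+1%:R^-1 (J N) wk; exact: H.
  by apply: cvgN; exact: Gv.
(* Two errors of order 1 / (N + 1) add up: the residual of the approximate solution and the distance
   between discrete and true Laplacian. *)
have Lv x : lap (v [::]) x + w x = 0.
  pose C := \sum_j \sum_i `|W [:: j; i; i]|.
  apply: (@ulim0 _ U _ infU
    (fun N => \sum_i G N (D [:: i; i]) x + w x)
    (n%:R * (n%:R * C * 2) / 2 + 2 * W [::])).
    apply: cvgD; last exact: cvg_cst.
    rewrite /lap; under eq_bigr do rewrite !dvE.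
    by apply: (cvg_big add_continuous) => i _; exact: Gv.
  move=> N; set h : R := (2 * N.+1)%:R^-1.
  have h0 : 0 < h by rewrite invr_gt0 ltr0n.
  have [_] := HJ N k _ _ (Dk [::]) (HW [::]) x.
  rewrite -/(G N (D [::])) -/h => L1.
  have := @discrete_lap_bound (G N (D [::])) C (smooth_jacobi _ _ _ (sD _)) _ x h h0.
  have -> : lap (G N (D [::])) x = \sum_i G N (D [:: i; i]) x.
    by apply: eq_bigr => i _; rewrite !GD.
  set L := discrete_lap _ _ _ in L1 *; set S := \sum_i _ => L2.
  have -> : S + w x = (L + w x) - (L - S) by ring.
  apply: le_trans (ler_normB _ _) _; rewrite mulrDl addrC; apply: lerD => //.
  apply: le_trans (L2 _) _.
    move=> j i y; rewrite !GD; apply: le_trans (GW _ _ _) _.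
    apply: le_trans (ler_norm _) _.
    rewrite /C (bigD1 j) //= (bigD1 i) //= -addrA lerDl.
    by rewrite addr_ge0 ?sumr_ge0 // => *; rewrite ?sumr_ge0.
  rewrite /h natrM invfM le_eqVlt; apply/predU1P; left.
  by field; rewrite nat1r pnatr_eq0.
(* The limit solves lap v = - w, whence the sign. *)
exists (fun x => - v [::] x); split; first exact: smoothN.
  split=> [i x|x]; [by rewrite vk.1|by rewrite vk.2].
apply/funext => x; have -> : lap (fun x => - v [::] x) x = - lap (v [::]) x.
  rewrite /lap -sumrN; apply: eq_bigr => i _.
  by rewrite partialN // partialN //; exact: smooth_partial.
by apply/eqP; rewrite -subr_eq0 -opprD oppr_eq0 Lv.
Qed.

End Poisson.

(** * Twisted matrix-valued functions *)

Section Laplacian.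
Variables (R : realType) (m : nat).
Local Notation n := m.+1.
Local Notation E := 'cV[R]_n.
Local Notation e i := (delta_mx i 0 : E).
Implicit Types (V : normedModType R) (x y v : E) (i k : 'I_n).

Lemma lapD V (f g : E -> V) : smooth f -> smooth g ->
  lap (fun x => f x + g x) = fun x => lap f x + lap g x.
Proof.
move=> sf sg; apply/funext => x; rewrite -big_split; apply: eq_bigr => i _ /=.
by rewrite partialD // partialD //; exact: smooth_partial.
Qed.

Lemma lapZ V (f : E -> V) (c : R) : smooth f ->
  lap (fun x => c *: f x) = fun x => c *: lap f x.
Proof.
move=> sf; apply/funext => x; rewrite scaler_sumr; apply: eq_bigr => i _ /=.
by rewrite partialZ // partialZ //; exact: smooth_partial.
Qed.

Lemma lapB V (f g : E -> V) : smooth f -> smooth g ->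
  lap (fun x => f x - g x) = fun x => lap f x - lap g x.
Proof.
move=> sf sg; apply/funext => x; rewrite -sumrB; apply: eq_bigr => i _ /=.
by rewrite partialB // partialB //; exact: smooth_partial.
Qed.

Lemma lap_sum V (I : Type) (r : seq I) (P : pred I) (f : I -> E -> V) :
  (forall l, P l -> smooth (f l)) ->
  lap (fun x => \sum_(l <- r | P l) f l x) =
  fun x => \sum_(l <- r | P l) lap (f l) x.
Proof.
move=> sf; apply/funext => x; rewrite exchange_big; apply: eq_bigr => i _ /=.
rewrite partial_sum // partial_sum // => l Pl; exact/smooth_partial/sf.
Qed.

Lemma lap_shift V (f : E -> V) v : lap (fun x => f (x + v)) = fun x => lap f (x + v).
Proof.
by apply/funext => x; apply: eq_bigr => i _; rewrite !partial_shift.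
Qed.

Section MatrixValued.
Variables (p q : nat).
Implicit Types (F : E -> 'M[R]_(p.+1, q.+1)).

Lemma lap_entry F a b : smooth F -> lap (fun x => F x a b) = fun x => lap F x a b.
Proof.
move=> sF; apply/funext => x; rewrite summxE; apply: eq_bigr => i _.
by rewrite partial_entry // partial_entry //; exact: smooth_partial.
Qed.

Lemma antiperiodic_harmonic_mx_eq0 k F : smooth F -> antiperiodic k F ->
  lap F = (fun=> 0) -> F = fun=> 0.
Proof.
move=> sF [F2 Fk] LF; apply/funext => x; apply/matrixP => a b; rewrite mxE.
have -> // := congr1 (fun f => f x)
  (@antiperiodic_harmonic_eq0 _ _ k (fun x => F x a b) _ _ _).
- exact: smooth_entry.
- by split=> [i y|y]; [rewrite F2|rewrite Fk mxE].
- by rewrite lap_entry // LF; apply/funext => y; rewrite mxE.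
Qed.

Lemma antiperiodic_poisson_mx k F : smooth F -> antiperiodic k F ->
  exists U, [/\ smooth U, antiperiodic k U & lap U = F].
Proof.
move=> sF [F2 Fk].
have H a b : exists u, [/\ smooth u, antiperiodic k u & lap u = fun x => F x a b].
  apply: antiperiodic_poisson; first exact: smooth_entry.
  by split=> [i y|y]; [rewrite F2|rewrite Fk mxE].
pose u a b := sval (cid (H a b)).
have uP a b : [/\ smooth (u a b), antiperiodic k (u a b) &
  lap (u a b) = fun x => F x a b] by exact: svalP (cid (H a b)).
pose U x := \matrix_(a, b) u a b x.
have UE a b : (fun x => U x a b) = u a b by apply/funext => x; rewrite mxE.
have sU : smooth U by apply: smooth_mx => a b; rewrite UE; case: (uP a b).
exists U; split=> //.
  by split=> [i x|x]; apply/matrixP => a b; rewrite !mxE;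
     have [_ [u2 uk] _] := uP a b; rewrite ?u2 ?uk.
apply/funext => x; apply/matrixP => a b.
have := congr1 (fun f => f x) (lap_entry a b sU); rewrite /= UE => <-.
by have [_ _ ->] := uP a b.
Qed.

End MatrixValued.

Section Sandwich.
Variables (p : nat) (A B : 'M[R]_p.+1).
Implicit Types (F : E -> 'M[R]_p.+1).

Let entryE F a b : (fun x => (A *m F x *m B) a b) =
  fun x => \sum_d \sum_c (A a c * B d b) *: F x c d.
Proof.
apply/funext => x; rewrite mxE; apply: eq_bigr => d _.
rewrite mxE mulr_suml; apply: eq_bigr => c _.
by rewrite mulrAC.
Qed.

Lemma smooth_mulmx F : smooth F -> smooth (fun x => A *m F x *m B).
Proof.
move=> sF; apply: smooth_mx => a b; rewrite entryE.
by do 2![apply: smooth_sum => ? _]; apply: smoothZ; exact: smooth_entry.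
Qed.

Lemma partial_mulmx F i : smooth F ->
  partial i (fun x => A *m F x *m B) = fun x => A *m partial i F x *m B.
Proof.
move=> sF; apply/funext => x; apply/matrixP => a b.
have := congr1 (fun f => f x) (partial_entry i a b (smooth_mulmx sF)).
rewrite /= => <-; have := congr1 (fun f => f x) (entryE (partial i F) a b).
rewrite /= => ->; rewrite entryE.
have sE c d : smooth (fun x => (A a c * B d b) *: F x c d).
  by apply: smoothZ; exact: smooth_entry.
rewrite partial_sum => [|d _]; last by apply: smooth_sum => c _; exact: sE.
apply: eq_bigr => d _; rewrite partial_sum => [|c _]; last exact: sE.
apply: eq_bigr => c _; rewrite partialZ; last exact: smooth_entry.
by rewrite partial_entry.
Qed.

Lemma lap_mulmx F : smooth F ->
  lap (fun x => A *m F x *m B) = fun x => A *m lap F x *m B.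
Proof.
move=> sF; apply/funext => x; rewrite mulmx_sumr mulmx_suml.
apply: eq_bigr => i _; rewrite partial_mulmx // partial_mulmx //.
exact: smooth_partial.
Qed.

End Sandwich.

Section Transpose.
Variables (p : nat).
Implicit Types (F : E -> 'M[R]_p.+1).

Lemma smooth_tr F : smooth F -> smooth (fun x => (F x)^T).
Proof.
move=> sF; apply: smooth_mx => a b.
by under eq_fun do rewrite mxE; exact: smooth_entry.
Qed.

Lemma partial_tr F i : smooth F ->
  partial i (fun x => (F x)^T) = fun x => (partial i F x)^T.
Proof.
move=> sF; apply/funext => x; apply/matrixP => a b.
have := congr1 (fun f => f x) (partial_entry i a b (smooth_tr sF)) => /= <-.
rewrite mxE; have := congr1 (fun f => f x) (partial_entry i b a sF) => /= <-.
by under eq_fun do rewrite mxE.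
Qed.

Lemma lap_tr F : smooth F -> lap (fun x => (F x)^T) = fun x => (lap F x)^T.
Proof.
move=> sF; apply/funext => x; rewrite /lap raddf_sum.
by apply: eq_bigr => i _; rewrite partial_tr // partial_tr //; exact: smooth_partial.
Qed.

End Transpose.

(** * The Poisson equation for functions twisted by commuting involutions *)

Section Twisted.
Variables (p : nat) (t : 'I_n -> 'M[R]_p.+1).
Hypotheses (tt : forall i, t i *m t i = 1%:M) (t_sym : forall i, (t i)^T = t i).
Hypothesis tC : forall i j, t i *m t j = t j *m t i.
Hypothesis t_nofix : forall X : 'M[R]_p.+1, X^T = - X ->
  (forall i, t i *m X *m t i = X) -> X = 0.
Implicit Types (F u : E -> 'M[R]_p.+1).

(** Equivariance under the unit translations only, [t i] being its own inverse. The other group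
    elements are brought in later through uniqueness of solutions. *)
Definition twisted F := [/\ smooth F, forall x, (F x)^T = - F x &
  forall i x, F (x + e i) = t i *m F x *m t i].

Lemma twist2 i (X : 'M[R]_p.+1) : t i *m (t i *m X *m t i) *m t i = X.
Proof. by rewrite !mulmxA tt mul1mx -mulmxA tt mulmx1. Qed.

Lemma twistC i j (X : 'M[R]_p.+1) :
  t i *m (t j *m X *m t j) *m t i = t j *m (t i *m X *m t i) *m t j.
Proof. by rewrite !mulmxA tC -!mulmxA [t j *m t i]tC. Qed.

Lemma twisted_periodic F i x : twisted F -> F (x + 2%:R *: e i) = F x.
Proof.
by move=> [_ _ Ft]; rewrite scaler_nat mulr2n addrA !Ft twist2.
Qed.

(** For each [j] the difference of [u] and its conjugate by [t j] is harmonic and changes sign under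
    translation by [e j], hence vanishes. So the values of [u] are fixed by all the [t j], and
    [t_nofix] applies. *)
Lemma twisted_harmonic_eq0 u : twisted u -> lap u = (fun=> 0) -> u = fun=> 0.
Proof.
move=> ut Lu; have [su uso uE] := ut.
have key j : (fun x => u x - t j *m u x *m t j) = fun=> 0.
  have stu := smooth_mulmx (t j) (t j) su.
  apply: (@antiperiodic_harmonic_mx_eq0 _ _ j); first exact: smoothB.
    split=> [i x|x]; first by rewrite twisted_periodic.
    by rewrite uE twist2 opprB.
  rewrite lapB // lap_mulmx // Lu.
  by apply/funext => x; rewrite mulmx0 mul0mx subrr.
apply/funext => x; apply: t_nofix => // j.
have := congr1 (fun f => f x) (key j) => /= /eqP.
by rewrite subr_eq0 => /eqP.
Qed.

Lemma twistedD F G : twisted F -> twisted G -> twisted (fun x => F x + G x).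
Proof.
move=> [sF Fs FE] [sG Gs GE]; split; first exact: smoothD.
- by move=> x; rewrite linearD /= Fs Gs opprD.
- by move=> i x; rewrite FE GE mulmxDr mulmxDl.
Qed.

Lemma twistedZ F (c : R) : twisted F -> twisted (fun x => c *: F x).
Proof.
move=> [sF Fs FE]; split; first exact: smoothZ.
- by move=> x; rewrite linearZ /= Fs scalerN.
- by move=> i x; rewrite FE -scalemxAr -scalemxAl.
Qed.

Lemma twistedB F G : twisted F -> twisted G -> twisted (fun x => F x - G x).
Proof.
move=> tF tG; under eq_fun do rewrite -scaleN1r.
by apply: twistedD => //; exact: twistedZ.
Qed.

Lemma twisted0 : twisted (fun=> 0).
Proof.
split=> [|x|i x]; first exact: smooth_cst.
  by rewrite trmx0 oppr0.
by rewrite mulmx0 mul0mx.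
Qed.

Lemma twisted_twist F j : twisted F -> twisted (fun x => t j *m F x *m t j).
Proof.
move=> [sF Fs FE]; split; first exact: smooth_mulmx.
- by move=> x; rewrite !trmx_mul t_sym Fs !(mulmxN, mulNmx) mulmxA.
- by move=> i x; rewrite FE twistC.
Qed.

Lemma twisted_partial F i : twisted F -> twisted (partial i F).
Proof.
move=> [sF Fs FE]; split; first exact: smooth_partial.
- move=> x; have := congr1 (fun f => f x) (partial_tr i sF) => /= <-.
  under eq_fun do rewrite Fs.
  by rewrite partialN.
- move=> j x; have := congr1 (fun f => f x) (partial_shift F (e j) i) => /= <-.
  under eq_fun do rewrite FE.
  by rewrite partial_mulmx.
Qed.

Lemma twisted_sum (I : Type) (r : seq I) (P : pred I) (f : I -> E -> 'M[R]_p.+1) :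
  (forall l, P l -> twisted (f l)) -> twisted (fun x => \sum_(l <- r | P l) f l x).
Proof.
move=> tf; elim: r => [|l r IH].
  by under eq_fun do rewrite big_nil; exact: twisted0.
under eq_fun do rewrite big_cons; case Pl: (P l) => //.
by apply: twistedD => //; exact: tf.
Qed.

Lemma twisted_partialC F i j : twisted F ->
  partial i (partial j F) = partial j (partial i F).
Proof.
move=> tF; have [sF _ _] := tF.
apply/funext => x; apply/matrixP => a b.
have sp k := smooth_partial k sF; have sE := smooth_entry a b sF.
have E k l y : partial k (partial l F) y a b =
    partial k (partial l (fun z => F z a b)) y.
  by rewrite partial_entry // partial_entry.
have bE : bounded_derivatives (fun z => F z a b).
  apply: periodic_bounded_derivatives => // k y.
  by rewrite (twisted_periodic k y tF).
have C := congr1 (fun h => h x) (partialC i j sE bE).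
exact: etrans (E i j x) (etrans C (esym (E j i x))).
Qed.

(** On the (-1)-eigenspace of conjugation by [t j], twisted means antiperiodic in direction [j], so
    a solution [u] exists. Its skew-symmetry and its behaviour under the other translations follow
    from uniqueness: the defects are antiperiodic and harmonic. *)
Lemma twisted_poisson_odd j F : twisted F ->
  (forall x, t j *m F x *m t j = - F x) -> exists2 u, twisted u & lap u = F.
Proof.
move=> Ft Fj; have [sF Fs FE] := Ft.
have Fa : antiperiodic j F.
  by split=> [i x|x]; [exact: twisted_periodic|rewrite FE Fj].
have [u [su [u2 uj] Lu]] := antiperiodic_poisson_mx sF Fa.
exists u => //; split=> //.
  move=> x; apply/eqP; rewrite -addr_eq0; apply/eqP.
  have : (fun x => (u x)^T + u x) = fun=> 0.
    apply: (@antiperiodic_harmonic_mx_eq0 _ _ j).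
    - by apply: smoothD => //; exact: smooth_tr.
    - by split=> [i y|y]; [rewrite u2|rewrite uj opprD linearN].
    - rewrite lapD ?lap_tr ?Lu //; last exact: smooth_tr.
      by apply/funext => y; rewrite Fs addNr.
  by move/(congr1 (fun f => f x)).
move=> i x; apply/eqP; rewrite -subr_eq0; apply/eqP.
have : (fun x => u (x + e i) - t i *m u x *m t i) = fun=> 0.
  have s1 := smooth_shift (e i) su; have s2 := smooth_mulmx (t i) (t i) su.
  apply: (@antiperiodic_harmonic_mx_eq0 _ _ j); first exact: smoothB.
  - split=> [l y|y]; first by rewrite [y + _ + _]addrAC !u2.
    by rewrite [y + _ + _]addrAC !uj mulmxN mulNmx -opprD.
  - rewrite lapB // lap_shift lap_mulmx // Lu.
    by apply/funext => y; rewrite FE subrr.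
by move/(congr1 (fun f => f x)).
Qed.

(* Splits off the (-1)-eigenspaces of the [t j] one at a time. *)
Theorem twisted_poisson F : twisted F -> exists2 u, twisted u & lap u = F.
Proof.
(* Here [d] counts the involutions not yet known to fix [F]. When none is left, [F] vanishes by
   [t_nofix]. *)
suff H d : (d <= n)%N -> forall F, twisted F ->
    (forall i : 'I_n, (i < n - d)%N -> forall x, t i *m F x *m t i = F x) ->
    exists2 u, twisted u & lap u = F.
  by move=> tF; apply: (H n) => // i; rewrite subnn.
elim: d => [_|d IH dn] G tG Gfix.
  exists (fun=> 0); first exact: twisted0.
  have G0 x : G x = 0.
    apply: t_nofix => [|i]; first by case: tG.
    by apply: Gfix; rewrite subn0.
  apply/funext => x; rewrite G0 /lap big1 // => i _.
  by rewrite !partial_cst.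
have jn : (n - d.+1 < n)%N by lia.
pose j := Ordinal jn.
(* The components of [G] in the two eigenspaces of conjugation by [t j]: [Gm] is odd and solved
   directly, [Gp] is fixed by one more involution and falls to the induction hypothesis. *)
pose Gm x := 2^-1 *: (G x - t j *m G x *m t j).
pose Gp x := 2^-1 *: (G x + t j *m G x *m t j).
have tj := twisted_twist j tG.
have tGm : twisted Gm by apply: twistedZ; exact: twistedB.
have tGp : twisted Gp by apply: twistedZ; exact: twistedD.
have [um tum Lum] : exists2 u, twisted u & lap u = Gm.
  apply: (twisted_poisson_odd (j := j) tGm) => x.
  by rewrite -scalemxAr -scalemxAl mulmxBr mulmxBl twist2 -scalerN opprB.
have [up tup Lup] : exists2 u, twisted u & lap u = Gp.
  apply: IH => //; first exact: ltnW.
  move=> i; rewrite leq_eqVlt => /orP[/eqP ij|ij] x.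
    have -> : i = j by apply: val_inj => /=; lia.
    by rewrite /Gp -scalemxAr -scalemxAl mulmxDr mulmxDl twist2 [in LHS]addrC.
  rewrite /Gp -scalemxAr -scalemxAl mulmxDr mulmxDl twistC Gfix //; lia.
exists (fun x => um x + up x); first exact: twistedD.
have [sm _ _] := tum; have [sp _ _] := tup.
rewrite lapD // Lum Lup; apply/funext => x.
rewrite /Gm /Gp -scalerDr addrACA addNr addr0 -[G x + G x]mulr2n.
rewrite -[G x *+ 2]scaler_nat scalerA.
by rewrite mulVf ?scale1r // pnatr_eq0.
Qed.

End Twisted.

End Laplacian.

(** * The Klein four-group and the holonomy *)

Section Involutions.
Variable F : realFieldType.

(** Sylvester's determinant identity, from two triangular factorisations of one block matrix. *)
Lemma det_1D_mulmxC m n (C : 'M[F]_(m, n)) (D : 'M[F]_(n, m)) :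
  \det (1%:M + C *m D) = \det (1%:M + D *m C).
Proof.
pose M := block_mx 1%:M (- C) D (1%:M : 'M[F]_n).
have E1 : block_mx 1%:M 0 D 1%:M *m block_mx 1%:M (- C) 0 (1%:M + D *m C) = M.
  rewrite mulmx_block !(mul1mx, mulmx1, mul0mx, mulmx0, addr0, add0r).
  by rewrite mulmxN addrCA addNr addr0.
have E2 : block_mx 1%:M (- C) 0 1%:M *m block_mx (1%:M + C *m D) 0 D 1%:M = M.
  rewrite mulmx_block !(mul1mx, mulmx1, mul0mx, mulmx0, addr0, add0r).
  by rewrite mulNmx addrK.
have := congr1 (fun A => \det A) E1; rewrite -E2 !det_mulmx.
by rewrite !(det_ublock, det_lblock) !det1 !(mul1r, mulr1).
Qed.

(** For a rank factorisation Q = C D, the equation C (D C) D = C D may be cancelled on both sides.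
    Trace and determinant formulas then reduce to an identity matrix of size the rank. *)
Lemma idempotent_rank_factorisation n (Q : 'M[F]_n) : Q *m Q = Q ->
  row_base Q *m col_base Q = 1%:M.
Proof.
move=> QQ; apply: (row_full_inj (col_base_full Q)).
apply: (row_free_inj (row_base_free Q)).
by rewrite /= mulmx1 mulmx_base mulmxA -mulmxA !mulmx_base.
Qed.

Lemma idempotent_trace n (Q : 'M[F]_n) : Q *m Q = Q -> \tr Q = (\rank Q)%:R.
Proof.
move=> /idempotent_rank_factorisation QE.
by rewrite -[in LHS](mulmx_base Q) mxtrace_mulC QE mxtrace1.
Qed.

Lemma idempotent_det_reflection n (Q : 'M[F]_n) : Q *m Q = Q ->
  \det (1%:M - 2 *: Q) = (-1) ^+ \rank Q.
Proof.
move=> /idempotent_rank_factorisation QE.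
rewrite -[in LHS](mulmx_base Q) -scalerN -mulmxN scalemxAl det_1D_mulmxC.
rewrite mulNmx -scalemxAr QE -[X in X - _]scale1r -scalerBl.
by rewrite detZ det1 mulr1; congr (_ ^+ _); lra.
Qed.

(** Write a = 1 - 2 Q with Q the projection onto the (-1)-eigenspace. Determinant 1 makes the rank
    of Q even; ranks 0 and 4 are a = 1 and a = -1, and rank 2 gives trace 4 - 4. *)
Lemma SO4_involution_trace (a : 'M[F]_4) : a *m a = 1%:M -> \det a = 1 ->
  a <> 1%:M -> a <> - 1%:M -> \tr a = 0.
Proof.
move=> aa da a1 aN1.
pose Q := 2^-1 *: (1%:M - a).
have aQ : a = 1%:M - 2 *: Q.
  by rewrite /Q scalerA mulfV ?pnatr_eq0 // scale1r opprB addrC subrK.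
have QQ : Q *m Q = Q.
  rewrite /Q -scalemxAr -scalemxAl mulmxBr mulmx1 mulmxBl mul1mx aa.
  rewrite [X in _ *: (_ *: X)](_ : _ = 2 *: (1%:M - a)).
    by congr (_ *: _); rewrite scalerA mulVf ?pnatr_eq0 // scale1r.
  by rewrite scaler_nat mulr2n opprB.
have := idempotent_det_reflection QQ; rewrite -aQ da.
have tQ := idempotent_trace QQ.
have taQ : \tr a = 4 - 2 * \tr Q.
  by rewrite {1}aQ linearB linearZ /= mxtrace1.
have := rank_leq_row Q.
case rE : (\rank Q) tQ => [|[|[|[|[|r]]]]] // tQ _ /eqP; last first.
- move=> _; case: aN1; rewrite aQ.
  have Qu : row_full Q by rewrite /row_full rE.
  have -> : Q = 1%:M by apply: (row_full_inj Qu); rewrite mulmx1.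
  by rewrite -{1}(scale1r 1%:M) -scalerBl (_ : 1 - 2 = -1) ?scaleN1r //; lra.
- by rewrite exprS sqrrN expr1n mulr1 => /eqP H; lra.
- by rewrite taQ tQ; lra.
- by rewrite expr1 => /eqP H; lra.
- case: a1; rewrite aQ; move/eqP: rE; rewrite mxrank_eq0 => /eqP ->.
  by rewrite scaler0 subr0.
Qed.

(* [P] has rank one, so [P X P] is a multiple of the symmetric matrix [P]. *)
Lemma skew_rank1_compression n (P X : 'M[F]_n) : P^T = P -> X^T = - X ->
  \rank P = 1%N -> P *m X *m P = 0.
Proof.
move=> Ps Xs rP.
have : exists (C : 'M[F]_(n, \rank P)) (D : 'M[F]_(\rank P, n)), P = C *m D.
  by exists (col_base P), (row_base P); rewrite mulmx_base.
rewrite rP => -[C [D PE]].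
have cE : P *m X *m P = (D *m X *m C) 0 0 *: P.
  have -> : P *m X *m P = C *m (D *m X *m C) *m D by rewrite PE !mulmxA.
  by rewrite [Y in C *m Y *m _]mx11_scalar mul_mx_scalar -scalemxAl -PE.
have := congr1 trmx cE; rewrite !trmx_mul linearZ /= Ps Xs mulNmx mulmxN mulmxA => /esym.
rewrite -cE => /eqP; rewrite -subr_eq0 opprK -mulr2n -scaler_nat scaler_eq0 pnatr_eq0 /=.
by move=> /eqP.
Qed.

(** The four matrices (1 + s a) (1 + t b) / 4 with signs s, t are the projections onto the joint
    eigenspaces. The vanishing traces give each of them trace 1, hence rank 1. Since [X] commutes
    with such a P, X P = P X P, which is zero for skew [X]. *)
Lemma klein_four_centraliser (a b X : 'M[F]_4) :
  a *m a = 1%:M -> b *m b = 1%:M -> a *m b = b *m a -> a^T = a -> b^T = b ->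
  \tr a = 0 -> \tr b = 0 -> \tr (a *m b) = 0 ->
  a *m X = X *m a -> b *m X = X *m b -> X^T = - X -> X = 0.
Proof.
move=> aa bb ab aT bT ta tb tab aX bX XT.
have comp (s t : F) : s * s = 1 -> t * t = 1 ->
    X *m ((1%:M + s *: a) *m (1%:M + t *: b)) = 0.
  move=> ss tt; set S := 1%:M + s *: a; set T := 1%:M + t *: b.
  have SS : S *m S = 2 *: S.
    rewrite /S mulmxDr mulmxDl mulmxDl !mulmx1 !mul1mx -scalemxAr -scalemxAl aa.
    by rewrite scalerA ss scale1r scaler_nat mulr2n [X in _ + X]addrC.
  have TT : T *m T = 2 *: T.
    rewrite /T mulmxDr mulmxDl mulmxDl !mulmx1 !mul1mx -scalemxAr -scalemxAl bb.
    by rewrite scalerA tt scale1r scaler_nat mulr2n [X in _ + X]addrC.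
  have ST : S *m T = T *m S.
    rewrite /S /T !mulmxDr !mulmxDl !mulmx1 !mul1mx -!scalemxAr -!scalemxAl ab.
    by rewrite !scalerA mulrC addrACA.
  have XS : S *m X = X *m S.
    by rewrite mulmxDr mulmxDl mulmx1 mul1mx -scalemxAr -scalemxAl aX.
  have XT' : T *m X = X *m T.
    by rewrite mulmxDr mulmxDl mulmx1 mul1mx -scalemxAr -scalemxAl bX.
  pose P := 4^-1 *: (S *m T).
  have PP : P *m P = P.
    rewrite /P -scalemxAr -scalemxAl -mulmxA [T *m (S *m T)]mulmxA -ST.
    rewrite -[S *m T *m T]mulmxA TT -!scalemxAr mulmxA SS -scalemxAl.
    by rewrite !scalerA; congr (_ *: _); field.
  have PT : P^T = P.
    rewrite /P linearZ /= trmx_mul ST; congr (_ *: (_ *m _)).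
      by rewrite /T linearD linearZ /= trmx1 bT.
    by rewrite /S linearD linearZ /= trmx1 aT.
  have tP : \tr P = 1.
    rewrite /P linearZ /= /S /T mulmxDr !mulmxDl !mulmx1 mul1mx -!scalemxAr -!scalemxAl.
    by rewrite !linearD !linearZ /= ta tb tab mxtrace1; field.
  have rP : \rank P = 1%N.
    by have := idempotent_trace PP; rewrite tP => /eqP; rewrite eq_sym pnatr_eq1 => /eqP.
  have XP : X *m P = P *m X.
    by rewrite /P -scalemxAr -scalemxAl mulmxA -XS -!mulmxA -XT'.
  have : X *m P = 0 by rewrite -PP mulmxA XP (skew_rank1_compression PT).
  by rewrite /P -scalemxAr => /eqP; rewrite scaler_eq0 invr_eq0 pnatr_eq0 => /eqP.
(* The four projections add up to the identity. *)
have XE : 4 *: X = X *m ((1%:M + 1 *: a) *m (1%:M + 1 *: b))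
    + X *m ((1%:M + 1 *: a) *m (1%:M + (-1) *: b))
    + (X *m ((1%:M + (-1) *: a) *m (1%:M + 1 *: b))
    + X *m ((1%:M + (-1) *: a) *m (1%:M + (-1) *: b))).
  have dbl (c : 'M[F]_4) : 1%:M + 1 *: c + (1%:M + (-1) *: c) = 2%:M.
    rewrite scale1r scaleN1r addrACA subrr addr0.
    by rewrite -[2%:M]scalemx1 scaler_nat mulr2n.
  rewrite -!mulmxDr dbl -mulmxDl dbl mul_scalar_mx.
  by rewrite -scalemx1 scalerA -scalemxAr mulmx1; congr (_ *: _); lra.
have : 4 *: X = 0.
  by rewrite XE !comp ?addr0 // ?mulr1 ?mulrNN ?mulr1.
by move=> /eqP; rewrite scaler_eq0 pnatr_eq0 => /eqP.
Qed.

End Involutions.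

(** * The orbifold group and its representation *)

Section OrbifoldGroupFacts.
Variable R : realType.
Local Notation E := 'cV[R]_8.
Local Notation e i := (delta_mx i 0 : E).
Implicit Types (g h : pi1orb R) (i j : 'I_8) (x : E).

Lemma pi1_actM g h x : aff_act (g * h)%g x = aff_act g (aff_act h x).
Proof. exact: (aff_actM (pi1_val g) (pi1_val h)). Qed.

Lemma pi1_act_inj g h : aff_act g =1 aff_act h -> g = h.
Proof. by move=> gh; apply/val_inj/aff_act_inj. Qed.

Lemma tau_act i x : aff_act (tau R i) x = x + e i.
Proof.
apply/matrixP => j k; rewrite (ord1 k) signed_shiftE /= !mxE.
by rewrite eqxx andbT.
Qed.

Definition sign_diagonal (A : 'M[R]_8) :=
  exists2 s : 'rV[R]_8, A = diag_mx s & forall i, s 0 i * s 0 i = 1.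

Lemma signed_shift_sign_diagonal l b :
  sign_diagonal (lin (signed_shift l b : affiso R 8)).
Proof.
exists (signs R l) => // i; rewrite mxE.
by case: ifP => _; rewrite ?mulrNN mulr1.
Qed.

(** The sign matrices form a group containing the linear parts of the generators. This is what makes
    pull-back diagonal in the basis of the dx_J. *)
Lemma pi1_sign_diagonal g : sign_diagonal (lin g).
Proof.
case: g => g /= /asboolP gP.
apply: (gP [set g : affiso R 8 | sign_diagonal (lin g)]); split; last first.
  move=> a [[[[|]|]|]|]; try by move=> ->; exact: signed_shift_sign_diagonal.
  by case=> i _ <-; exact: signed_shift_sign_diagonal.
split.
  exists (const_mx 1) => [|i]; last by rewrite mxE mulr1.
  by rewrite diag_const_mx.
move=> a b [s sE ss] [r rE rr].
exists (\row_i (s 0 i * r 0 i)) => [|i]; last by rewrite mxE mulrACA ss rr mulr1.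
rewrite -[lin (a / b)%g]/(lin a *m (lin b)^T) sE rE tr_diag_mx.
apply/matrixP => i j; rewrite mul_diag_mx !mxE.
by case: eqP => [->|_]; rewrite ?mulr1n // !mulr0n mulr0.
Qed.

Lemma diag_delta (s : 'rV[R]_8) i : diag_mx s *m e i = s 0 i *: e i.
Proof.
apply/matrixP => j k; rewrite mul_diag_mx !mxE (ord1 k) eqxx andbT.
by case: eqP => [->|_]; rewrite ?mulr1 ?mulr0.
Qed.

(** Conjugation by [g] turns the translation by e_i into the translation by s_i e_i; for s_i = -1
    this is written without inverses. *)
Lemma tau_conj g (s : 'rV[R]_8) i : lin g = diag_mx s ->
  (s 0 i = 1 -> (g * tau R i = tau R i * g)%g) /\
  (s 0 i = -1 -> (tau R i * g * tau R i = g)%g).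
Proof.
move=> gs; split=> si; apply: pi1_act_inj => x; rewrite !pi1_actM !tau_act.
  by rewrite /aff_act mulmxDr gs diag_delta si scale1r addrAC.
by rewrite /aff_act mulmxDr gs diag_delta si scaleN1r addrAC subrK.
Qed.

Lemma tauC i j : (tau R i * tau R j = tau R j * tau R i)%g.
Proof. by apply: pi1_act_inj => x; rewrite !pi1_actM !tau_act addrAC. Qed.

Section Representation.
Variable rho : {multiplicative pi1orb R -> SO R 4}.
Hypotheses (rho_alpha : rho (alpha R) = 1%g) (rho_beta : rho (beta R) = 1%g).

Definition rtau i : 'M[R]_4 := rho (tau R i).

Lemma SO_val_mul (a b : SO R 4) : SO_val (a * b)%g = (a : 'M[R]_4) *m b.
Proof. by []. Qed.

(** [alpha] inverts the first four translations under conjugation and [beta] the last four; as both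
    act trivially under [rho], each [rho (tau i)] equals its inverse. *)
Lemma rtau_invol i : rtau i *m rtau i = 1%:M.
Proof.
have H (a : pi1orb R) (l : seq nat) (b : E) : pi1_val a = signed_shift l b ->
    i.+1 \in l -> rho a = 1%g -> rtau i *m rtau i = 1%:M.
  move=> aE il ra; have [|_ ] := @tau_conj a (signs R l) i; first by rewrite aE.
  rewrite mxE il => /(_ erefl)/(congr1 rho); rewrite !gmulfM ra mulg1.
  by move=> /(congr1 (@SO_val R 4)).
have [i4|i4] := ltnP i 4.
  by apply: (H (alpha R) _ _ erefl) => //; rewrite !inE; lia.
by apply: (H (beta R) _ _ erefl) => //; have := ltn_ord i; rewrite !inE; lia.
Qed.

Lemma rtau_comm i j : rtau i *m rtau j = rtau j *m rtau i.
Proof. by rewrite /rtau -!SO_val_mul -!gmulfM tauC. Qed.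

Lemma rtau_sym i : (rtau i)^T = rtau i.
Proof.
have := SO_Tmul (rho (tau R i)); rewrite -/(rtau i) => H.
by rewrite -[LHS]mulmx1 -(rtau_invol i) mulmxA H mul1mx.
Qed.

(** [g] conjugates [tau i] to itself or to its inverse, and [rho] does not distinguish the two. *)
Lemma rho_rtau g (s : 'rV[R]_8) i : lin g = diag_mx s -> s 0 i * s 0 i = 1 ->
  (rho g : 'M[R]_4) *m rtau i = rtau i *m rho g.
Proof.
move=> gs /eqP; rewrite -expr2 sqrf_eq1 => /orP[/eqP si|/eqP si].
  have [/(_ si) H _] := tau_conj i gs.
  by rewrite /rtau -!SO_val_mul -!gmulfM H.
have [_ /(_ si) H] := tau_conj i gs.
rewrite -[in LHS]H !gmulfM !SO_val_mul -/(rtau i) -!mulmxA rtau_invol.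
by rewrite mulmx1.
Qed.

Lemma Ad_tau i X : Ad (rho (tau R i)) X = rtau i *m X *m rtau i.
Proof. by rewrite /Ad -[SO_val (_^-1)%g]/(rtau i)^T rtau_sym. Qed.

Lemma Ad_tr (a : SO R 4) X : (Ad a X)^T = Ad a X^T.
Proof.
by rewrite /Ad -[SO_val (_^-1)%g]/((a : 'M[R]_4)^T) !trmx_mul trmxK mulmxA.
Qed.

Lemma Ad_K (a : SO R 4) X : Ad (a^-1)%g (Ad a X) = X.
Proof.
rewrite /Ad invgK -[SO_val (_^-1)%g]/((a : 'M[R]_4)^T) !mulmxA SO_Tmul mul1mx.
by rewrite -mulmxA SO_Tmul mulmx1.
Qed.

Lemma Ad_VK (a : SO R 4) X : Ad a (Ad (a^-1)%g X) = X.
Proof. by rewrite -{1}[a]invgK Ad_K. Qed.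

Lemma Ad_rtau g (s : 'rV[R]_8) i X : lin g = diag_mx s -> s 0 i * s 0 i = 1 ->
  Ad ((rho g)^-1)%g (rtau i *m X *m rtau i) = rtau i *m Ad ((rho g)^-1)%g X *m rtau i.
Proof.
move=> gs si; have H := rho_rtau gs si.
rewrite /Ad invgK -[SO_val (_^-1)%g]/((rho g : 'M[R]_4)^T).
have H' : (rho g : 'M[R]_4)^T *m rtau i = rtau i *m (rho g : 'M[R]_4)^T.
  by have := congr1 trmx H; rewrite !trmx_mul rtau_sym => ->.
by rewrite !mulmxA H' -!mulmxA H.
Qed.

Hypothesis klein : exists K : set (SO R 4),
  [/\ klein_four K, K `<=` generated (range (fun i => rho (tau R i))) &
      ~ K (SO4_opp1 R)].

(** A fixed [X] commutes with every [rtau i], hence with the group they generate and with [K]. The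
    elements a, b and a b of [K] are involutions other than 1 and -1, so they have trace 0 and the
    centraliser lemma applies. *)
Lemma rtau_nofix (X : 'M[R]_4) : X^T = - X ->
  (forall i, rtau i *m X *m rtau i = X) -> X = 0.
Proof.
move=> XT Xfix; have [K [[a [b [[aa bb ab] [[a1 b1 anb] KE]]]] KG Kopp]] := klein.
have cX c : K c -> (c : 'M[R]_4) *m X = X *m c.
  move=> /KG/(_ [set d : SO R 4 | (d : 'M[R]_4) *m X = X *m d]); apply.
  split; last first.
    move=> _ [i _ <-]; rewrite /= -/(rtau i).
    by rewrite -[in RHS](Xfix i) -mulmxA rtau_invol mulmx1.
  split; first by rewrite /= mul1mx mulmx1.
  move=> x y /= xX yX.
  have yX' : (y : 'M[R]_4)^T *m X = X *m (y : 'M[R]_4)^T.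
    rewrite -[in LHS](mulmx1 X) -(SO_mulT y) mulmxA mulmxA -(mulmxA _ X) -yX.
    by rewrite !mulmxA SO_Tmul mul1mx.
  by rewrite -mulmxA yX' !mulmxA xX.
have Ka : K a by rewrite KE; constructor 2.
have Kb : K b by rewrite KE; constructor 3.
have Kab : K (a * b)%g by rewrite KE; constructor 4.
have sym (c : SO R 4) : (c * c = 1)%g ->
    ((c : 'M[R]_4) *m c = 1%:M) * ((c : 'M[R]_4)^T = c).
  move=> /(congr1 (@SO_val R 4)) cc; split=> //.
  by rewrite -[LHS]mulmx1 -[1%:M]cc mulmxA SO_Tmul mul1mx.
have tr0 (c : SO R 4) : (c * c = 1)%g -> K c -> c <> 1%g -> \tr (c : 'M[R]_4) = 0.
  move=> cc Kc c1; apply: SO4_involution_trace.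
  - by rewrite sym.
  - exact: SO_det.
  - by move=> cE; apply: c1; apply: val_inj.
  - by move=> cE; apply: Kopp; rewrite -(_ : c = SO4_opp1 R) //; apply: val_inj.
have abab : (a * b * (a * b) = 1)%g by rewrite {1}ab mulgA -(mulgA b) aa mulg1.
apply: (@klein_four_centraliser _ (a : 'M[R]_4) b) => //.
- by rewrite sym.
- by rewrite sym.
- by rewrite -!SO_val_mul ab.
- by rewrite sym.
- by rewrite sym.
- exact: tr0.
- exact: tr0.
- rewrite -SO_val_mul; apply: tr0 => // ab1; apply: anb.
  by rewrite -[a]mulg1 -bb mulgA ab1 mul1g.
- exact: cX.
- exact: cX.
Qed.

End Representation.

End OrbifoldGroupFacts.

(** * Octonions and Lambda^2_7 *)

(* The seven 2-forms [dx_{0 j} + ...] spanning Lambda^2_7, each as a list of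
   oriented index pairs, counted from 0; as antisymmetric matrices they
   anticommute and square to -1. *)
Definition octonion_pairs (j : nat) : seq (nat * nat) :=
  nth [::] [::
    [:: (0, 1); (2, 3); (4, 5); (6, 7)];
    [:: (0, 2); (3, 1); (4, 6); (7, 5)];
    [:: (0, 3); (1, 2); (7, 4); (6, 5)];
    [:: (0, 4); (5, 1); (6, 2); (3, 7)];
    [:: (0, 5); (1, 4); (2, 7); (3, 6)];
    [:: (0, 6); (7, 1); (2, 4); (5, 3)];
    [:: (0, 7); (1, 6); (5, 2); (4, 3)]]%N j.

(** The matrices have integer entries indexed by plain naturals so that the identities below can be
    decided by evaluation; [oct] carries them to [R]. *)
Definition octz (j p q : nat) : int :=
  ((p, q) \in octonion_pairs j)%:Z - ((q, p) \in octonion_pairs j)%:Z.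

(** A sum that evaluates under [vm_compute]; [sumzE] turns it into a big sum. *)
Definition sumz (n : nat) (f : nat -> int) : int :=
  foldr (fun i s => f i + s) 0 (iota 0 n).

Definition kron (p q : nat) : int := if p == q then 1 else 0.

Definition alln (n : nat) (P : pred nat) := all P (iota 0 n).

Lemma allnP n (P : pred nat) : alln n P -> forall i : 'I_n, P i.
Proof. by move=> /allP H i; apply: H; rewrite mem_iota /= add0n. Qed.

Lemma octz_antisym (j : 'I_7) (p q : 'I_8) : octz j q p = - octz j p q.
Proof.
have /allnP/(_ j)/allnP/(_ p)/allnP/(_ q)/eqP // : alln 7 (fun j => alln 8 (fun p =>
  alln 8 (fun q => octz j q p == - octz j p q))) by vm_compute.
Qed.

(** For every vector v the eight vectors v, A_1 v, ..., A_7 v are orthogonal of length |v|, so the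
    sum of their dyadic squares is |v|^2 times the identity. This is that relation polarised in
    v. *)
Lemma octz_dual_clifford (p k m l : 'I_8) :
  sumz 7 (fun j => octz j p m * octz j k l + octz j k m * octz j p l)
    + (kron p m * kron k l + kron k m * kron p l) = 2 * kron p k * kron m l.
Proof.
have /allnP/(_ p)/allnP/(_ k)/allnP/(_ m)/allnP/(_ l)/eqP // :
  alln 8 (fun p => alln 8 (fun k => alln 8 (fun m => alln 8 (fun l =>
  sumz 7 (fun j => octz j p m * octz j k l + octz j k m * octz j p l)
    + (kron p m * kron k l + kron k m * kron p l) == 2 * kron p k * kron m l)))).
by vm_compute.
Qed.

(** The Clifford relations A_i A_j^T + A_j A_i^T = 2 delta_ij, entry by entry. *)
Lemma octz_clifford (i j : 'I_7) (p k : 'I_8) :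
  sumz 8 (fun m => octz i p m * octz j k m + octz i k m * octz j p m)
    = 2 * kron i j * kron p k.
Proof.
have /allnP/(_ i)/allnP/(_ j)/allnP/(_ p)/allnP/(_ k)/eqP // :
  alln 7 (fun i => alln 7 (fun j => alln 8 (fun p => alln 8 (fun k =>
  sumz 8 (fun m => octz i p m * octz j k m + octz i k m * octz j p m)
    == 2 * kron i j * kron p k)))).
by vm_compute.
Qed.

Lemma octz_orthogonal (i j : 'I_7) :
  sumz 8 (fun k => sumz 8 (fun l => if (k < l)%N then octz i k l * octz j k l else 0))
    = 4 * kron i j.
Proof.
have /allnP/(_ i)/allnP/(_ j)/eqP // : alln 7 (fun i => alln 7 (fun j =>
  sumz 8 (fun k => sumz 8 (fun l => if (k < l)%N then octz i k l * octz j k l else 0))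
    == 4 * kron i j)) by vm_compute.
Qed.

Definition inversions (P Q : pred nat) : nat :=
  sumn [seq (if P a then count (fun b => Q b && (b < a)%N) (iota 0 8) else 0%N)
       | a <- iota 0 8].

(** [Omega_pos] and [Omega_neg] hold the index sets of the terms of [Omega0] with coefficient 1 and
    -1, shifted to start at 0. *)
Definition Omega_pos : seq (seq nat) :=
  [:: [:: 0; 1; 2; 3]; [:: 0; 1; 4; 5]; [:: 0; 1; 6; 7]; [:: 0; 2; 4; 6];
      [:: 1; 3; 5; 7]; [:: 2; 3; 4; 5]; [:: 2; 3; 6; 7]; [:: 4; 5; 6; 7]]%N.

Definition Omega_neg : seq (seq nat) :=
  [:: [:: 0; 2; 5; 7]; [:: 0; 3; 4; 7]; [:: 0; 3; 5; 6]; [:: 1; 2; 4; 7];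
      [:: 1; 2; 5; 6]; [:: 1; 3; 4; 6]]%N.

Definition same_set (P : pred nat) (s : seq nat) :=
  all (fun a => P a == (a \in s)) (iota 0 8).

Definition Omegaz (P : pred nat) : int :=
  (count (same_set P) Omega_pos)%:Z - (count (same_set P) Omega_neg)%:Z.

Definition pairn (p q : nat) : pred nat := fun a => (a == p) || (a == q).

(** For p < q and k < l, the coefficient of dx_p /\ dx_q in the Hodge dual of Omega_0 /\ dx_k /\
    dx_l. Only the term of Omega_0 on the complement [I] of the four indices contributes, and [Jc]
    is the complement of {p, q}. *)
Definition hodge_coef (p q k l : nat) : int :=
  if pairn p q k || pairn p q l then 0 else
  let Jc a := ~~ pairn p q a in
  let I a := Jc a && ~~ pairn k l a in
  (-1) ^+ inversions Jc (pairn p q) * ((-1) ^+ inversions I (pairn k l) * Omegaz I).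

(** The matrix form of the identity behind Lambda^2_7: identity plus Hodge dual of Omega_0 /\ w
    equals the sum of the A_j (x) A_j. The right-hand side is 4 times the projection onto the span
    of the A_j. *)
Lemma hodge_coefE (p q k l : 'I_8) : (p < q)%N -> (k < l)%N ->
  hodge_coef p q k l + kron p k * kron q l = sumz 7 (fun j => octz j p q * octz j k l).
Proof.
have /allnP/(_ p)/allnP/(_ q)/allnP/(_ k)/allnP/(_ l) H :
  alln 8 (fun p => alln 8 (fun q => alln 8 (fun k => alln 8 (fun l =>
  (p < q)%N ==> (k < l)%N ==>
  (hodge_coef p q k l + kron p k * kron q l
    == sumz 7 (fun j => octz j p q * octz j k l)))))).
  by vm_compute.
by move=> pq kl; move: H; rewrite pq kl => /eqP.
Qed.

Section PairSums.
Variables (n : nat).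

Lemma set2_ltn_eq (p q k l : 'I_n) : (p < q)%N -> (k < l)%N ->
  ([set p; q]%SET == [set k; l]%SET) = (p == k) && (q == l).
Proof.
move=> pq kl; apply/eqP/andP => [E|[/eqP-> /eqP->] //].
have : p \in [set k; l]%SET by rewrite -E !inE eqxx.
have : q \in [set k; l]%SET by rewrite -E !inE eqxx orbT.
have : k \in [set p; q]%SET by rewrite E !inE eqxx.
rewrite !inE => /orP[/eqP ka|/eqP ka] /orP[/eqP qa|/eqP qa] /orP[/eqP pa|/eqP pa];
  subst; rewrite ?eqxx //; lia.
Qed.

Lemma sum_pairs (V : nmodType) (F : {set 'I_n} -> V) :
  (forall K : {set 'I_n}, #|K| != 2 -> F K = 0) ->
  \sum_K F K = \sum_(k < n) \sum_(l < n | (k < l)%N) F [set k; l]%SET.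
Proof.
move=> F0; rewrite pair_big_dep /= (bigID (fun K : {set 'I_n} => #|K| == 2)) /=.
rewrite [X in _ + X]big1 // addr0.
rewrite (partition_big (fun p : 'I_n * 'I_n => [set p.1; p.2]%SET)
  (fun K : {set 'I_n} => #|K| == 2)) /=; last first.
  by move=> [a b] /= ab; rewrite cards2 neq_ltn ab.
apply: eq_bigr => K /cards2P[a [b [ab ->]]] {K}.
wlog {ab}ab : a b / (a < b)%N.
  move=> W; have := ab; rewrite neq_ltn => /orP[|ba]; first exact: W.
  by rewrite [[set a; b]%SET]finset.setUC; exact: W.
rewrite (big_pred1 (a, b)) // => -[c d] /=; rewrite xpair_eqE.
apply/andP/andP => [[cd]|[/eqP-> /eqP->]]; last by rewrite eqxx.
by rewrite set2_ltn_eq // => /andP.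
Qed.

End PairSums.

(** * Coefficients of wedge products and of Omega_0 *)

Section Wedge.
Variables (R : realType).

Lemma dxE n (i : 'I_n) (I : {set 'I_n}) : dx R i I = (I == [set i]%SET)%:R.
Proof. by rewrite ffunE. Qed.

Lemma wedge_dx n (V : lmodType R) (i : 'I_n) (u : form n V) (K : {set 'I_n}) :
  wedge (dx R i) u K =
  if i \in K then shuffle_sign R [set i]%SET (K :\ i)%SET *: u (K :\ i)%SET else 0.
Proof.
rewrite ffunE; case: ifPn => iK.
rewrite (bigD1 [set i]%SET) ?finset.sub1set //= dxE eqxx mulr1 big1 ?addr0 //.
  by move=> I /andP[_ /negPf Ii]; rewrite dxE Ii mulr0 scale0r.
rewrite big1 // => I IK; rewrite dxE; case: eqP => [E|_]; last by rewrite mulr0 scale0r.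
by move: IK; rewrite E finset.sub1set (negPf iK).
Qed.

(** The set counted in [shuffle_sign] is a classical set used as a predicate; this makes membership
    in it boolean. *)
Lemma mem_boolset (T : Type) (P : pred T) x : (x \in [set y | P y]) = P x.
Proof. by apply/idP/idP => [/set_mem|/mem_set]. Qed.

Lemma shuffle_sign_lt n (I J : {set 'I_n}) :
  (forall i j, i \in I -> j \in J -> (i < j)%N) -> shuffle_sign R I J = 1.
Proof.
move=> IJ; rewrite /shuffle_sign eq_card0 // => -[i j].
by rewrite mem_boolset /=; apply/negbTE/negP => /and3P[iI jJ]; rewrite ltnNge ltnW // IJ.
Qed.

Definition indf n (L : {set 'I_n}) : form n R := [ffun I : {set 'I_n} => (I == L)%:R].

Lemma indfE n (L I : {set 'I_n}) : indf L I = (I == L)%:R.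
Proof. by rewrite ffunE. Qed.

Lemma wedge_dx_indf n (i : 'I_n) (L : {set 'I_n}) :
  (forall l, l \in L -> (i < l)%N) -> wedge (dx R i) (indf L) = indf (i |: L)%SET.
Proof.
move=> iL; apply/ffunP => K; rewrite wedge_dx !indfE.
have iNL : i \notin L by apply/negP => /iL; rewrite ltnn.
case: ifPn => iK.
  rewrite (_ : (K == _) = (K :\ i == L)%SET); last first.
    apply/eqP/eqP => [->|<-]; first by rewrite setU1K.
    by rewrite finset.setD1K.
  case: eqP => [E|_]; last by rewrite scaler0.
  rewrite shuffle_sign_lt ?scale1r // => a b; rewrite E inE => /eqP -> /iL //.
rewrite (_ : (K == _) = false) //; apply/negbTE; apply: contra iK => /eqP ->.
exact: setU11.
Qed.

Definition bits (P : pred nat) : {set 'I_8} := [set i : 'I_8 | P i]%SET.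

Lemma shuffle_sign_bits (P Q : pred nat) :
  shuffle_sign R (bits P) (bits Q) = (-1) ^+ inversions P Q.
Proof.
congr (_ ^+ _); rewrite -sum1_card big_mkcond /=.
rewrite -(pair_bigA _ (fun a b : 'I_8 => if (a, b) \in
  [set p : 'I_8 * 'I_8 | [&& p.1 \in bits P, p.2 \in bits Q & (p.2 < p.1)%N]]
  then 1 else 0)%N) /=.
rewrite /inversions sumnE big_map -[iota 0 8]/(index_iota 0 8) big_mkord.
apply: eq_bigr => a _; case: ifPn => Pa; last first.
  by rewrite big1 // => b _; rewrite mem_boolset !inE /= (negPf Pa).
rewrite -sum1_count [RHS]big_mkcond big_mkord; apply: eq_bigr => b _.
by rewrite mem_boolset !inE /= Pa.
Qed.

Lemma bits_eq (P : pred nat) (s : seq nat) (L : {set 'I_8}) :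
  (forall i : 'I_8, (i \in L) = (val i \in s)) -> (bits P == L) = same_set P s.
Proof.
move=> Ls; apply/eqP/allP => [E a|H].
  rewrite mem_iota add0n => /= a8.
  have := congr1 (fun A : {set 'I_8} => Ordinal a8 \in A) E.
  by rewrite !inE Ls /= => ->.
apply/finset.setP => i; rewrite inE Ls; apply/eqP/H.
by rewrite mem_iota add0n /=.
Qed.

Lemma dx4E a b c d (P : pred nat) : (0 < a < b)%N -> (b < c)%N -> (c < d <= 8)%N ->
  dx4 R a b c d (bits P) = (same_set P [:: a.-1; b.-1; c.-1; d.-1])%:R.
Proof.
move=> ab bc cd; rewrite /dx4 -[dx R (inord d.-1)]/(indf [set inord d.-1]%SET).
have ordE k : (0 < k <= 8)%N -> (inord k.-1 : 'I_8) = k.-1 :> nat.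
  by move=> k8; rewrite inordK //; lia.
have [a8 b8 c8 d8] : [/\ (0 < a <= 8)%N, (0 < b <= 8)%N, (0 < c <= 8)%N & (0 < d <= 8)%N].
  by split; lia.
rewrite !wedge_dx_indf ?indfE.
- rewrite (@bits_eq _ [:: a.-1; b.-1; c.-1; d.-1]) // => i.
  by rewrite !inE -!val_eqE /= !ordE // !orbA.
- by move=> l; rewrite !inE -!val_eqE /= !ordE // => /or3P[]/eqP->; lia.
- by move=> l; rewrite !inE -!val_eqE /= !ordE // => /orP[]/eqP->; lia.
- by move=> l; rewrite !inE -!val_eqE /= !ordE // => /eqP->; lia.
Qed.

Lemma Omega0E (P : pred nat) : Omega0 R (bits P) = (Omegaz P)%:~R.
Proof.
have addE (f g : form 8 R) I : (f + g) I = f I + g I by rewrite ffunE.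
have oppE (f : form 8 R) I : (- f) I = - f I by rewrite ffunE.
have := fun a b c d => @dx4E a b c d P; rewrite /Omega0.
move: (dx4 R) => D DE; rewrite !addE !oppE !DE // /Omegaz intrB -!pmulrn.
move: (same_set P) => f; rewrite /= !natrD addr0.
by ring.
Qed.

End Wedge.

(** * Lambda^2_7 as the span of the octonionic forms *)

Section Lambda27.
Variables (R : realType).
Implicit Types (V : lmodType R) (i j : 'I_7) (p q k l : 'I_8).

Definition oct j p q : R := (octz j p q)%:~R.

Lemma sumzE n (f : nat -> int) : ((sumz n f)%:~R : R) = \sum_(i < n) (f i)%:~R.
Proof.
rewrite -(big_mkord xpredT (fun i : nat => (f i)%:~R : R)) /index_iota subn0 /sumz.
elim: (iota 0 n) => [|a s IH] /=; first by rewrite big_nil.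
by rewrite big_cons intrD IH.
Qed.

Lemma kronE n (a b : 'I_n) : ((kron a b)%:~R : R) = (a == b)%:R.
Proof. by rewrite /kron -val_eqE /=; case: eqP. Qed.

Lemma oct_antisym j p q : oct j q p = - oct j p q.
Proof. by rewrite /oct octz_antisym rmorphN. Qed.

Lemma oct_diag j p : oct j p p = 0.
Proof. by have := oct_antisym j p p; lra. Qed.

Lemma oct_dual_clifford p k m l :
  \sum_j (oct j p m * oct j k l + oct j k m * oct j p l)
    + ((p == m)%:R * (k == l)%:R + (k == m)%:R * (p == l)%:R)
  = 2 * (p == k)%:R * (m == l)%:R.
Proof.
have := congr1 (fun z : int => z%:~R : R) (octz_dual_clifford p k m l).
rewrite /= intrD sumzE intrD !intrM !kronE => <-; congr (_ + _).
by apply: eq_bigr => j _; rewrite intrD !intrM.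
Qed.

Lemma oct_clifford i j p k :
  \sum_m (oct i p m * oct j k m + oct i k m * oct j p m)
  = 2 * (i == j)%:R * (p == k)%:R.
Proof.
have := congr1 (fun z : int => z%:~R : R) (octz_clifford i j p k).
rewrite /= sumzE !intrM !kronE => <-.
by apply: eq_bigr => m _; rewrite intrD !intrM.
Qed.

Lemma oct_orthogonal i j :
  \sum_(k < 8) \sum_(l < 8 | (k < l)%N) oct i k l * oct j k l = 4 * (i == j)%:R.
Proof.
have := congr1 (fun z : int => z%:~R : R) (octz_orthogonal i j).
rewrite /= sumzE intrM kronE => <-; apply: eq_bigr => k _.
rewrite sumzE [LHS]big_mkcond; apply: eq_bigr => l _.
by case: ifP => // _; rewrite intrM.
Qed.

Definition octform j : form 8 R :=
  [ffun J : {set 'I_8} =>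
    \sum_(k < 8) \sum_(l < 8 | (k < l)%N && (J == [set k; l]%SET)) oct j k l].

Lemma octform_pair j p q : (p < q)%N -> octform j [set p; q]%SET = oct j p q.
Proof.
move=> pq; rewrite ffunE (bigD1 p) //= [X in _ + X]big1 => [|k kp]; last first.
  rewrite big_pred0 // => l; apply/negbTE/negP => /andP[kl].
  by rewrite set2_ltn_eq // => /andP[/eqP pk]; rewrite pk eqxx in kp.
rewrite addr0 (big_pred1 q) // => l; case: (ltnP p l) => pl /=.
  by rewrite set2_ltn_eq // eqxx eq_sym.
by apply/esym/negbTE/eqP => lq; rewrite lq leqNgt pq in pl.
Qed.

Lemma octform_kform j : is_kform 2 (octform j : form 8 R^o).
Proof.
move=> J J2; rewrite ffunE big1 // => k _; rewrite big_pred0 // => l.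
apply/negbTE/negP => /andP[kl /eqP E]; move: J2.
by rewrite E cards2 -[k == l]val_eqE /= (ltn_eqF kl).
Qed.

Lemma pairing_octform V j (w : form 8 V) :
  pairing (octform j) w =
  \sum_(k < 8) \sum_(l < 8 | (k < l)%N) oct j k l *: w [set k; l]%SET.
Proof.
rewrite /pairing sum_pairs => [|K K2]; last first.
  by rewrite octform_kform // scale0r.
apply: eq_bigr => k _; apply: eq_bigr => l kl.
by rewrite octform_pair.
Qed.

Lemma pairing_octform2 i j :
  pairing (octform i) (octform j : form 8 R^o) = 4 * (i == j)%:R.
Proof.
rewrite pairing_octform -oct_orthogonal; apply: eq_bigr => k _.
by apply: eq_bigr => l kl; rewrite octform_pair.
Qed.

Lemma pairingB V (z : form 8 R) (u w : form 8 V) :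
  pairing z (u - w) = pairing z u - pairing z w.
Proof.
by rewrite /pairing -sumrB; apply: eq_bigr => I _; rewrite !ffunE scalerBr.
Qed.

(** The orthogonal projection onto the span of the [octform j], which are orthogonal of squared norm
    4. *)
Definition octproj V (w : form 8 V) : form 8 V :=
  [ffun J : {set 'I_8} => 4^-1 *: \sum_j octform j J *: pairing (octform j) w].

Lemma octproj_kform V (w : form 8 V) : is_kform 2 (octproj w).
Proof.
move=> J J2; rewrite ffunE big1 ?scaler0 // => j _.
by rewrite octform_kform // scale0r.
Qed.

Lemma pairing_octproj V (z : form 8 R) (w : form 8 V) :
  pairing z (octproj w) =
  4^-1 *: \sum_j pairing z (octform j : form 8 R^o) *: pairing (octform j) w.
Proof.
rewrite /pairing; under eq_bigr do rewrite ffunE scalerA mulrC -scalerA scaler_sumr.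
rewrite -scaler_sumr exchange_big; congr (_ *: _); apply: eq_bigr => j _ /=.
by rewrite scaler_suml; apply: eq_bigr => I _; rewrite scalerA.
Qed.

Lemma pairing_octform_octproj V j (w : form 8 V) :
  pairing (octform j) (octproj w) = pairing (octform j) w.
Proof.
rewrite pairing_octproj (bigD1 j) //= big1 => [|i /negPf ij]; last first.
  by rewrite pairing_octform2 eq_sym ij mulr0 scale0r.
by rewrite pairing_octform2 eqxx mulr1 addr0 scalerA mulVf ?scale1r // pnatr_eq0.
Qed.

Lemma hodge_kform V (w : form 8 V) : is_kform 2 w ->
  is_kform 2 (hodge (wedge (Omega0 R) w)).
Proof.
move=> w2 J J2; rewrite ffunE ffunE big1 ?scaler0 // => I IJ.
have [E|/w2->] := eqVneq #|(~: J :\: I)%SET| 2%N; last by rewrite scaler0.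
(* Omega_0 has no coefficient on sets [I] of size other than 4; for size 4 the degrees add up to 4 +
   2 + 2 = 8, contrary to [J2]. *)
have [I4|I4] := eqVneq #|I| 4%N; last first.
  pose P a := (a < 8)%N && (inord a \in I).
  have -> : I = bits P.
    by apply/finset.setP => i; rewrite !inE /P ltn_ord inord_val.
  rewrite Omega0E.
  suff -> : Omegaz P = 0 by rewrite mulr0 scale0r.
  have same4 s : uniq s -> all (fun a => (a < 8)%N) s -> size s = 4%N ->
      same_set P s = false.
    move=> us s8 s4; apply/negbTE/negP => /allP Ps; case/eqP: I4.
    rewrite -[RHS]s4 -(size_map (fun a => inord a : 'I_8)) -(card_uniqP _); last first.
      rewrite map_inj_in_uniq // => a b /(allP s8) a8 /(allP s8) b8 /(congr1 val) /=.
      by rewrite !inordK.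
    apply: eq_card => i; have := Ps i; rewrite mem_iota /= add0n ltn_ord => /(_ isT)/eqP.
    rewrite /P ltn_ord inord_val /= => ->; apply/idP/mapP => [is_|[a sa ->]].
      by exists (val i) => //; rewrite inord_val.
    by rewrite inordK // (allP s8).
  by rewrite /Omegaz /= !same4.
case/eqP: J2; have := cardsC J; rewrite card_ord.
have := cardsID I (~: J)%SET; rewrite (finset.setIidPr IJ) E I4; lia.
Qed.

(** Compares coefficients of dx_p /\ dx_q through [hodge_coefE]. It shows the eigenvalue 3 on the
    span of the [octform j] and -1 on its orthogonal complement. *)
Lemma hodge_wedge_Omega V (w : form 8 V) : is_kform 2 w ->
  w + hodge (wedge (Omega0 R) w) = 4 *: octproj w.
Proof.
move=> w2; apply/ffunP => J.
have -> : (w + hodge (wedge (Omega0 R) w)) J = w J + hodge (wedge (Omega0 R) w) J.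
  by rewrite ffunE.
have -> : (4 *: octproj w) J = 4 *: octproj w J by rewrite ffunE.
have [J2|J2] := eqVneq #|J| 2%N; last first.
  by rewrite w2 // hodge_kform // octproj_kform // scaler0 addr0.
have [p [q [pq JE]]] : exists p q : 'I_8, (p < q)%N /\ J = [set p; q]%SET.
  move/eqP: J2 => /cards2P[a [b [ab ->]]].
  move: ab; rewrite neq_ltn => /orP[ab|ba]; first by exists a, b.
  by exists b, a; rewrite finset.setUC.
rewrite [octproj w J]ffunE scalerA mulfV ?pnatr_eq0 // scale1r.
(* The wedge sums over the index set [I] of Omega_0; the involution sending [I] to its complement in
   [~: J] turns this into a sum over the index set [K] of [w], of size 2. *)
pose F (K : {set 'I_8}) : V := if (K \subset ~: J)%SET then
  (shuffle_sign R (~: J) J * (shuffle_sign R (~: J :\: K) K * Omega0 R (~: J :\: K)%SET))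
    *: w K else 0.
have -> : hodge (wedge (Omega0 R) w) J = \sum_K F K.
  rewrite ffunE ffunE scaler_sumr -big_mkcond /=.
  rewrite [RHS](reindex_onto (fun I => (~: J :\: I)%SET) (fun I => (~: J :\: I)%SET)) /=.
    rewrite [LHS]big_mkcond [RHS]big_mkcond; apply: eq_bigr => I _.
    rewrite finset.subsetDl /= finset.setDDr finset.setDv finset.set0U.
    have [IJ|IJ] := boolP (I \subset ~: J)%SET.
      by rewrite (finset.setIidPr IJ) eqxx scalerA.
    case: eqP => // E; case/negP: IJ; rewrite -E; exact: finset.subsetIl.
  move=> I IJ; rewrite finset.setDDr finset.setDv finset.set0U.
  exact/finset.setIidPr.
rewrite sum_pairs => [|K K2]; last by rewrite /F w2 // scaler0 if_same.
have wJ : w J = \sum_(k < 8) \sum_(l < 8 | (k < l)%N)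
    ((p == k)%:R * (q == l)%:R : R) *: w [set k; l]%SET.
  rewrite (bigD1 p) //= [X in _ + X]big1 => [|k /negPf kp]; last first.
    by rewrite big1 // => l _; rewrite eq_sym kp mul0r scale0r.
  rewrite (bigD1 q) //= big1 => [|l /andP[_ /negPf lq]]; last first.
    by rewrite [q == l]eq_sym lq mulr0 scale0r.
  by rewrite !eqxx mulr1 scale1r !addr0 JE.
have -> : \sum_j octform j J *: pairing (octform j) w =
    \sum_(k < 8) \sum_(l < 8 | (k < l)%N) 
      (\sum_j oct j p q * oct j k l) *: w [set k; l]%SET.
  rewrite (eq_bigr (fun j => \sum_(k < 8) \sum_(l < 8 | (k < l)%N)
      (oct j p q * oct j k l) *: w [set k; l]%SET)) => [|j _]; last first.
    rewrite {1}JE octform_pair // pairing_octform scaler_sumr.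
    apply: eq_bigr => k _; rewrite scaler_sumr.
    by apply: eq_bigr => l _; rewrite scalerA.
  rewrite exchange_big; apply: eq_bigr => k _ /=.
  rewrite exchange_big; apply: eq_bigr => l kl /=.
  by rewrite scaler_suml.
rewrite wJ -big_split; apply: eq_bigr => k _ /=.
rewrite -big_split; apply: eq_bigr => l kl /=.
have -> : F [set k; l]%SET = (hodge_coef p q k l)%:~R *: w [set k; l]%SET.
  have JP : J = bits (pairn p q) by apply/finset.setP => i; rewrite JE !inE.
  have CP : (~: J)%SET = bits (fun a => ~~ pairn p q a).
    by apply/finset.setP => i; rewrite JP !inE.
  have KP : [set k; l]%SET = bits (pairn k l) by apply/finset.setP => i; rewrite !inE.
  have DP : (~: J :\: [set k; l])%SET = bits (fun a => ~~ pairn p q a && ~~ pairn k l a).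
    by apply/finset.setP => i; rewrite CP KP !inE andbC.
  rewrite /F DP CP [in shuffle_sign _ _ J]JP [in shuffle_sign _ _ [set k; l]%SET]KP.
  rewrite !shuffle_sign_bits Omega0E /hodge_coef finset.subUset !finset.sub1set !inE.
  rewrite -negb_or; case: (pairn p q k || pairn p q l) => /=; first by rewrite scale0r.
  by rewrite !intrM !rmorphXn /= !rmorphN1.
rewrite -scalerDl; congr (_ *: _).
have := congr1 (fun z : int => z%:~R : R) (hodge_coefE pq kl).
rewrite /= sumzE intrD intrM !kronE addrC => ->.
by apply: eq_bigr => j _; rewrite intrM.
Qed.

Lemma Lambda27P V (w : form 8 V) : Lambda27 w <-> is_kform 2 w /\ octproj w = w.
Proof.
split=> [[w2 wE]|[w2 wE]]; split=> //.
  have n4 : 4 != 0 :> R by rewrite pnatr_eq0.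
  apply: (scalerI n4); rewrite -hodge_wedge_Omega // wE -[X in X + _]scale1r -scalerDl.
  by congr (_ *: _); lra.
have := hodge_wedge_Omega w2; rewrite wE => H.
rewrite -[LHS](addKr w) H -[X in - X + _]scale1r -scaleNr -scalerDl.
by congr (_ *: _); lra.
Qed.

Lemma octproj_Lambda27 V (w : form 8 V) : Lambda27 (octproj w).
Proof.
apply/Lambda27P; split; first exact: octproj_kform.
apply/ffunP => J; rewrite ffunE [RHS]ffunE.
by under eq_bigr do rewrite pairing_octform_octproj.
Qed.

Lemma octform_Lambda27 j : Lambda27 (octform j : form 8 R^o).
Proof.
apply/Lambda27P; split; first exact: octform_kform.
apply/ffunP => J; rewrite ffunE (bigD1 j) //= big1 => [|i /negPf ij]; last first.
  by rewrite pairing_octform2 ij mulr0 scaler0.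
rewrite pairing_octform2 eqxx addr0 mulr1 -[_ *: 4]/(_ * 4) -[_ *: _]/(_ * _).
by rewrite mulrCA mulVf ?mulr1 // pnatr_eq0.
Qed.

(** [pi27] is a choice with default 0, so both existence and uniqueness of the projection are shown.
    Pairing with any [z] in Lambda^2_7 is a combination of pairings with the [octform j]. *)
Lemma pi27E V (w : form 8 V) : is_kform 2 w -> pi27 w = octproj w.
Proof.
move=> w2; apply: xget_unique.
  split; first exact: octproj_Lambda27.
  move=> z /Lambda27P[z2 zE]; rewrite pairingB.
  have zp (u : form 8 V) : pairing z u =
      4^-1 *: \sum_j pairing (octform j) (z : form 8 R^o) *: pairing (octform j) u.
    rewrite /pairing -[in LHS]zE; under eq_bigr do rewrite ffunE.
    transitivity (\sum_I 4^-1 *: \sum_j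
      (pairing (octform j) (z : form 8 R^o) * octform j I) *: u I).
      apply: eq_bigr => I _; rewrite -scalerA scaler_suml; congr (_ *: _).
      by apply: eq_bigr => j _; rewrite mulrC.
    rewrite -scaler_sumr exchange_big; congr (_ *: _); apply: eq_bigr => j _ /=.
    by rewrite scaler_sumr; apply: eq_bigr => I _; rewrite scalerA.
  rewrite !zp; apply/eqP; rewrite subr_eq0; apply/eqP; congr (_ *: _).
  by apply: eq_bigr => j _; rewrite pairing_octform_octproj.
(* Uniqueness: [e] is its own [octproj], hence determined by its pairings with the [octform j],
   which are those of [w]. *)
move=> e [/Lambda27P[e2 eE] eo]; rewrite -eE; apply/ffunP => J.
rewrite !ffunE; congr (_ *: _); apply: eq_bigr => j _; congr (_ *: _).
have := eo _ (octform_Lambda27 j); rewrite pairingB => /eqP.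
by rewrite subr_eq0 => /eqP.
Qed.

End Lambda27.

(** * Pull-back and exterior derivative *)

Section DiagonalPullback.
Variables (R : realType) (n : nat).
Implicit Types (s : 'rV[R]_n) (I J : {set 'I_n}).

Lemma minor_diag s I J : #|I| = #|J| ->
  minor (diag_mx s) I J = if I == J then \prod_(i in I) s 0 i else 0.
Proof.
move=> cIJ; case: eqP => [<-|/eqP IJ].
  rewrite /minor (_ : \matrix_(_, _) _ = diag_mx (\row_a s 0 (enum_val a : 'I_n))).
    rewrite det_diag [RHS]big_enum_val /=; apply: eq_bigr => a _.
    by rewrite mxE.
  apply/matrixP => a b; rewrite !mxE -enum_val_nth; congr (_ *+ _).
  by rewrite (inj_eq enum_val_inj).
(* For distinct sets of equal size some [i] in [I] lies outside [J], and its row in the minor is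
   zero. *)
have /subsetPn[i iI iJ] : ~~ (I \subset J).
  apply: contra IJ => sIJ; rewrite eqEcard sIJ cIJ leqnn //.
rewrite /minor (expand_det_row _ (enum_rank_in iI i)) big1 // => b _.
rewrite !mxE enum_rankK_in //; case: eqP => [E|_]; last by rewrite mulr0n mul0r.
case/negP: iJ; rewrite {1}E -mem_enum; apply: mem_nth.
by rewrite -cardE -cIJ.
Qed.

Lemma lin_pull_diag (V : lmodType R) s (w : form n V) J :
  lin_pull (diag_mx s) w J = (\prod_(i in J) s 0 i) *: w J.
Proof.
rewrite ffunE (bigD1 J) //= big1 => [|I /andP[/eqP cI /negPf IJ]]; last first.
  by rewrite minor_diag // IJ scale0r.
by rewrite minor_diag // eqxx addr0.
Qed.

End DiagonalPullback.

Section ExteriorDerivative.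
Variables (R : realType) (m : nat).
Local Notation n := m.+1.
Local Notation E := 'cV[R]_n.
Variable V : normedModType R.
Implicit Types (w : E -> form n V) (x : E) (k l : 'I_n).

Lemma ext_dE w x (K : {set 'I_n}) : ext_d w x K =
  \sum_(i in K) shuffle_sign R [set i]%SET (K :\ i)%SET *:
    partial i (fun y => w y (K :\ i)%SET) x.
Proof.
rewrite /ext_d sum_ffunE [RHS]big_mkcond; apply: eq_bigr => i _.
by rewrite wedge_dx ffunE.
Qed.

Lemma ext_d_kform (d : nat) w x : (forall y, is_kform d (w y)) ->
  is_kform d.+1 (ext_d w x).
Proof.
move=> wd K Kd; rewrite ext_dE big1 // => i iK.
rewrite (_ : (fun y => w y (K :\ i)%SET) = fun=> 0); last first.
  apply/funext => y; apply: wd; apply: contra Kd => /eqP <-.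
  by rewrite [X in X == _](cardsD1 i) iK.
by rewrite partial_cst scaler0.
Qed.

Lemma ext_d_set1 w x k :
  ext_d w x [set k]%SET = partial k (fun y => w y finset.set0) x.
Proof.
rewrite ext_dE big_set1 finset.setDv shuffle_sign_lt ?scale1r // => i j _.
by rewrite inE.
Qed.

Lemma ext_d_set2 w x k l : (k < l)%N -> ext_d w x [set k; l]%SET =
  partial k (fun y => w y [set l]%SET) x - partial l (fun y => w y [set k]%SET) x.
Proof.
move=> kl; have kNl : k != l by rewrite -val_eqE /= ltn_eqF.
rewrite ext_dE big_setU1 ?inE //= big_set1.
have -> : ([set k; l] :\ k = [set l])%SET by rewrite setU1K // inE.
have -> : ([set k; l] :\ l = [set k])%SET by rewrite finset.setUC setU1K // inE eq_sym.
rewrite shuffle_sign_lt => [|i j]; last by rewrite !inE => /eqP-> /eqP->.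
rewrite scale1r (_ : shuffle_sign R [set l]%SET [set k]%SET = -1) ?scaleN1r //.
rewrite /shuffle_sign (@fintype.eq_card1 _ (l, k)) ?expr1 // => -[i j].
rewrite mem_boolset !inE /= xpair_eqE.
by case: eqP => [->|_] //; case: eqP => [->|_] //; rewrite kl.
Qed.

End ExteriorDerivative.

(** * Clifford relations contracted with Hessians *)

Section CliffordContraction.
Variables (R : realType) (V : lmodType R).
Implicit Types (i j : 'I_7) (p k m l : 'I_8).

Let half (u v : V) : u + u = 2 *: v -> u = v.
Proof.
have n2 : 2 != 0 :> R by rewrite pnatr_eq0.
by move=> H; apply: (scalerI n2); rewrite -H scaler_nat mulr2n.
Qed.

(** To be read with [H p k l] = d_p d_k b_l: a first-order operator on 1-forms, made of the
    divergence and the seven pairings of db with the A_j, composes with its adjoint to the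
    Laplacian, up to sign. As [H] is symmetric in p and k, only the symmetrised coefficients
    matter. *)
Lemma dual_clifford_contraction (H : 'I_8 -> 'I_8 -> 'I_8 -> V) m :
  (forall p k l, H p k l = H k p l) ->
  \sum_j \sum_p oct R j p m *: (\sum_k \sum_l oct R j k l *: H p k l)
    + \sum_k H m k k = \sum_p H p p m.
Proof.
move=> Hs; pose C p k l : R :=
  \sum_j oct R j p m * oct R j k l + (p == m)%:R * (k == l)%:R.
have E : \sum_j \sum_p oct R j p m *: (\sum_k \sum_l oct R j k l *: H p k l)
    + \sum_k H m k k = \sum_p \sum_k \sum_l C p k l *: H p k l.
  rewrite exchange_big /= [X in _ + X](_ : _ =
    \sum_p \sum_k \sum_l ((p == m)%:R * (k == l)%:R : R) *: H p k l); last first.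
    rewrite [RHS](bigD1 m) //= [X in _ + X]big1 ?addr0 => [|p /negPf pm]; last first.
      by apply: big1 => k _; apply: big1 => l _; rewrite pm mul0r scale0r.
    apply: eq_bigr => k _; rewrite [RHS](bigD1 k) //= big1 ?addr0 => [|l /negPf lk].
      by rewrite !eqxx mulr1 scale1r.
    by rewrite [k == l]eq_sym lk mulr0 scale0r.
  rewrite -big_split; apply: eq_bigr => p _ /=.
  rewrite (eq_bigr (fun j => \sum_k \sum_l (oct R j p m * oct R j k l) *: H p k l)).
    rewrite exchange_big -big_split; apply: eq_bigr => k _ /=.
    rewrite exchange_big -big_split; apply: eq_bigr => l _ /=.
    by rewrite /C scalerDl scaler_suml.
  move=> j _; rewrite scaler_sumr; apply: eq_bigr => k _.
  by rewrite scaler_sumr; apply: eq_bigr => l _; rewrite scalerA.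
(* Twice the sum is the sum plus its copy with p and k exchanged, whose coefficients are those of
   [oct_dual_clifford]. *)
rewrite E; apply: half.
rewrite [X in _ + X]exchange_big -big_split scaler_sumr; apply: eq_bigr => p _ /=.
rewrite -big_split (bigD1 p) //= [X in _ + X]big1 ?addr0 => [|k /negPf kp].
  rewrite -big_split (bigD1 m) //= big1 ?addr0 => [|l /negPf lm].
    rewrite -scalerDl; congr (_ *: _).
    have := oct_dual_clifford R p p m m; rewrite !eqxx !mulr1 => <-.
    by rewrite /C big_split /=; ring.
  rewrite -scalerDl (_ : C _ _ _ + _ = 0) ?scale0r //.
  have := oct_dual_clifford R p p m l; rewrite [m == l]eq_sym lm mulr0 => <-.
  by rewrite /C big_split /=; ring.
rewrite -big_split big1 // => l _ /=.
rewrite [H k p l]Hs -scalerDl (_ : C _ _ _ + _ = 0) ?scale0r //.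
have := oct_dual_clifford R p k m l; rewrite [p == k]eq_sym kp mulr0 mul0r => <-.
by rewrite /C big_split /=; ring.
Qed.

(** The other composite, to be read with [G j p k] = d_p d_k y_j for the coefficients y_j of a
    section of Lambda^2_7. The symmetrised coefficients are those of [oct_clifford]. *)
Lemma clifford_contraction (G : 'I_7 -> 'I_8 -> 'I_8 -> V) i :
  (forall j p k, G j p k = G j k p) ->
  \sum_p \sum_m oct R i p m *: (\sum_j \sum_k oct R j k m *: G j p k)
    = \sum_p G i p p.
Proof.
move=> Gs; pose C j p k : R := \sum_m oct R i p m * oct R j k m.
have E : \sum_p \sum_m oct R i p m *: (\sum_j \sum_k oct R j k m *: G j p k)
    = \sum_j \sum_p \sum_k C j p k *: G j p k.
  rewrite [RHS]exchange_big; apply: eq_bigr => p _ /=.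
  rewrite (eq_bigr (fun m => \sum_j \sum_k (oct R i p m * oct R j k m) *: G j p k)).
    rewrite exchange_big; apply: eq_bigr => j _ /=.
    rewrite exchange_big; apply: eq_bigr => k _ /=.
    by rewrite /C scaler_suml.
  move=> m _; rewrite scaler_sumr; apply: eq_bigr => j _.
  by rewrite scaler_sumr; apply: eq_bigr => k _; rewrite scalerA.
rewrite E; apply: half; rewrite -big_split (bigD1 i) //= [X in _ + X]big1 ?addr0.
  rewrite [X in _ + X]exchange_big -big_split scaler_sumr; apply: eq_bigr => p _ /=.
  rewrite -big_split (bigD1 p) //= [X in _ + X]big1 ?addr0 => [|k /negPf kp].
    rewrite -scalerDl; congr (_ *: _).
    by have := oct_clifford R i i p p; rewrite !eqxx !mulr1 big_split.
  rewrite [G i k p]Gs -scalerDl (_ : C _ _ _ + _ = 0) ?scale0r //.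
  have := oct_clifford R i i p k; rewrite [p == k]eq_sym kp mulr0 => <-.
  by rewrite big_split.
move=> j /negPf ji; rewrite [X in _ + X]exchange_big -big_split big1 // => p _ /=.
rewrite -big_split big1 // => k _ /=.
rewrite [G j k p]Gs -scalerDl (_ : C _ _ _ + _ = 0) ?scale0r //.
have := oct_clifford R i j p k; rewrite [i == j]eq_sym ji mulr0 mul0r => <-.
by rewrite big_split.
Qed.

End CliffordContraction.

(** * The deformation complex *)

Lemma oct_antisym_sum (R : realType) (V : lmodType R) (j : 'I_7)
    (D : 'I_8 -> 'I_8 -> V) :
  \sum_(k < 8) \sum_(l < 8 | (k < l)%N) oct R j k l *: (D k l - D l k) =
  \sum_k \sum_l oct R j k l *: D k l.
Proof.
rewrite [RHS](_ : _ = \sum_(k < 8) \sum_(l < 8 | (k < l)%N) oct R j k l *: D k l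
    + \sum_(k < 8) \sum_(l < 8 | (l < k)%N) oct R j k l *: D k l); last first.
  rewrite -big_split; apply: eq_bigr => k _ /=.
  rewrite (bigID (fun l : 'I_8 => (k < l)%N)) /=; congr (_ + _).
  rewrite (bigD1 k) ?ltnn //= oct_diag scale0r add0r; apply: eq_bigl => l.
  by rewrite -leqNgt ltn_neqAle andbC.
rewrite [X in _ + X](exchange_big_dep xpredT) //= -big_split; apply: eq_bigr => k _ /=.
rewrite -big_split; apply: eq_bigr => l _ /=.
by rewrite (oct_antisym R j k l) scaleNr scalerBr.
Qed.

Lemma pairing_ext_d (R : realType) (V : normedModType R) (w : 'cV[R]_8 -> form 8 V)
    (j : 'I_7) (x : 'cV[R]_8) :
  pairing (octform R j) (ext_d w x) =
  \sum_k \sum_l oct R j k l *: partial k (fun y => w y [set l]%SET) x.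
Proof.
rewrite pairing_octform -oct_antisym_sum; apply: eq_bigr => k _.
by apply: eq_bigr => l kl; rewrite ext_d_set2.
Qed.

Section Validity.
Variables (R : realType) (rho : {multiplicative pi1orb R -> SO R 4}).
Hypotheses (rho_alpha : rho (alpha R) = 1%g) (rho_beta : rho (beta R) = 1%g).
Hypothesis klein : exists K : set (SO R 4),
  [/\ klein_four K, K `<=` generated (range (fun i => rho (tau R i))) &
      ~ K (SO4_opp1 R)].
Local Notation E := 'cV[R]_8.
Local Notation V := 'M[R]_4.
Local Notation e i := (delta_mx i 0 : E).
Local Notation t := (rtau rho).
Local Notation twist := (twisted (rtau rho)).
Implicit Types (F phi : E -> V) (x y : E) (g : pi1orb R) (s : 'rV[R]_8).

Let tt := rtau_invol rho_alpha rho_beta.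
Let tsym := rtau_sym rho_alpha rho_beta.
Let tC := rtau_comm rho.
Let tfix := rtau_nofix rho_alpha rho_beta klein.

(* [F] is the component of an equivariant form on which the linear part
   [diag_mx s] of an element of the group acts by [c s]. *)
Definition equivariant (c : 'rV[R]_8 -> R) F :=
  forall g s, lin g = diag_mx s -> (forall i, s 0 i * s 0 i = 1) ->
    forall x, c s *: F (aff_act g x) = Ad (rho g) (F x).

(** The scalar by which [diag_mx s] acts on dx_J. *)
Definition sgn (J : {set 'I_8}) s : R := \prod_(i in J) s 0 i.

Lemma Ad_D (a : SO R 4) : {morph Ad a : X Y / X + Y}.
Proof. by move=> X Y; rewrite /Ad mulmxDr mulmxDl. Qed.

Lemma Ad_Z (a : SO R 4) c X : Ad a (c *: X) = c *: Ad a X.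
Proof. by rewrite /Ad -scalemxAr -scalemxAl. Qed.

Lemma Ad_0 (a : SO R 4) : Ad a 0 = 0.
Proof. by rewrite /Ad mulmx0 mul0mx. Qed.

(** Since all linear parts are diagonal, the equivariance of a form decouples into conditions on its
    components. *)
Lemma equivariant_section k w : Ad_section rho k w <->
  [/\ smooth_form w, forall x, is_kform k (w x), forall x J, so_alg (w x J) &
      forall J, equivariant (sgn J) (fun x => w x J)].
Proof.
split=> -[sw kw sow wE]; split=> //.
  move=> J g s gs _ x; have := congr1 (fun u : form 8 V => u J) (wE g x).
  by rewrite /pullback gs lin_pull_diag ffunE.
move=> g x; apply/ffunP => J; have [s gs ss] := pi1_sign_diagonal g.
by rewrite /pullback gs lin_pull_diag ffunE (wE J g s).
Qed.

Lemma partial_action F g s i : smooth F -> lin g = diag_mx s ->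
  partial i (fun x => F (aff_act g x)) = fun x => s 0 i *: partial i F (aff_act g x).
Proof.
move=> sF gs; rewrite /aff_act partial_affine //; apply/funext => x.
rewrite (bigD1 i) //= big1 ?addr0 => [|j /negPf ji].
  by rewrite gs !mxE eqxx mulr1n.
by rewrite gs !mxE ji mulr0n scale0r.
Qed.

Lemma lap_action F g s : smooth F -> lin g = diag_mx s ->
  (forall i, s 0 i * s 0 i = 1) ->
  lap (fun x => F (aff_act g x)) = fun x => lap F (aff_act g x).
Proof.
move=> sF gs ss; apply/funext => x; apply: eq_bigr => i _.
have sA : smooth (fun y => partial i F (aff_act g y)).
  by apply: smooth_affine; exact: smooth_partial.
rewrite (partial_action i sF gs) partialZ // (partial_action i _ gs).
  by rewrite scalerA ss scale1r.
exact: smooth_partial.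
Qed.

Lemma equivariant_twisted c F : c (const_mx 1) = 1 -> smooth F ->
  (forall x, so_alg (F x)) -> equivariant c F -> twist F.
Proof.
move=> c1 sF soF FE; split=> // i x.
have lt : lin (tau R i) = diag_mx (const_mx 1).
  rewrite /lin /=; congr diag_mx; apply/rowP => j; rewrite !mxE //.
have := FE _ _ lt (fun j => _) x; rewrite c1 scale1r tau_act Ad_tau //; apply => j.
by rewrite mxE mulr1.
Qed.

Lemma sgn_const J : sgn J (const_mx 1) = 1.
Proof. by rewrite /sgn big1 // => i _; rewrite mxE. Qed.

Lemma equivariant_partial c F i : smooth F -> equivariant c F ->
  equivariant (fun s => s 0 i * c s) (partial i F).
Proof.
move=> sF FE g s gs ss x.
have := congr1 (fun h => partial i h x) (funext (FE g s gs ss)).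
rewrite partialZ; last by apply: smooth_affine.
by rewrite (partial_action i sF gs) scalerA mulrC => ->; rewrite /Ad partial_mulmx.
Qed.

Lemma equivariantZ c F a : equivariant c F -> equivariant c (fun x => a *: F x).
Proof. by move=> FE g s gs ss x; rewrite scalerA mulrC -scalerA FE // Ad_Z. Qed.

Lemma equivariant_sum c (I : Type) (r : seq I) (F : I -> E -> V) :
  (forall k, equivariant c (F k)) -> equivariant c (fun x => \sum_(k <- r) F k x).
Proof.
move=> FE g s gs ss x; elim: r => [|k r IH]; first by rewrite !big_nil scaler0 Ad_0.
by rewrite !big_cons scalerDr IH FE // Ad_D.
Qed.

(** The transform of [phi] by a group element solves the same equation, because the Laplacian is
    invariant under isometries, and is again twisted. Uniqueness identifies it with [phi]. *)
Lemma equivariant_solution c F phi : twist phi -> lap phi = F ->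
  equivariant c F -> equivariant c phi.
Proof.
move=> tphi Lphi FE g s gs ss x; have [sphi sophi phiE] := tphi.
pose psi y := c s *: Ad ((rho g)^-1)%g (phi (aff_act g y)).
have sact : smooth (fun y => phi (aff_act g y)) by exact: smooth_affine.
have tpsi : twist psi.
  apply: twistedZ; split.
  - exact: smooth_mulmx.
  - by move=> y; rewrite Ad_tr sophi /Ad mulmxN mulNmx.
  - move=> i y; rewrite -(Ad_rtau rho_alpha rho_beta _ gs (ss i)); congr (Ad _ _).
    rewrite /aff_act mulmxDr gs diag_delta addrAC.
    have /eqP := ss i; rewrite -expr2 sqrf_eq1 => /orP[|] /eqP ->.
      by rewrite scale1r phiE.
    (* A reflected coordinate turns translation by [e i] into translation by [- e i]; both have the
       same effect, [t i] being an involution. *)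
    have phiN z : phi (z - e i) = t i *m phi z *m t i.
      by rewrite -[in RHS](subrK (e i) z) phiE twist2.
    by rewrite scaleN1r phiN.
have := @twisted_harmonic_eq0 _ _ _ _ tt tfix _ (twistedB tpsi tphi).
rewrite lapB //; last by case: tpsi.
rewrite lapZ; last exact: smooth_mulmx.
rewrite lap_mulmx // (lap_action sphi gs ss) Lphi => H.
have {}H : (fun y => psi y - phi y) = fun=> 0.
  apply: H; apply/funext => y.
  rewrite -[_ *m _ *m _]/(Ad ((rho g)^-1)%g (F (aff_act g y))).
  by rewrite -Ad_Z FE // Ad_K subrr.
have := congr1 (fun f => f x) H => /= /eqP; rewrite subr_eq0 => /eqP <-.
by rewrite /psi Ad_Z Ad_VK.
Qed.

Lemma section_twisted k w J : Ad_section rho k w -> twist (fun x => w x J).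
Proof.
move=> /equivariant_section[sw _ sow wE].
by apply: (equivariant_twisted (sgn_const J)) => //; exact: sw.
Qed.

Lemma irreducible_holds : irreducible rho.
Proof.
move=> f [fS df]; have tf := section_twisted finset.set0 fS.
have f0 : (fun x => f x finset.set0) = fun=> 0.
  apply: (twisted_harmonic_eq0 tt tfix tf).
  apply/funext => x; rewrite /lap big1 // => k _.
  rewrite (_ : partial k (fun y => f y finset.set0) = fun=> 0) ?partial_cst //.
  by apply/funext => y; rewrite -ext_d_set1 df ffunE.
apply/funext => x; apply/ffunP => J; rewrite ffunE.
have [->|J0] := eqVneq J finset.set0; first by have := congr1 (fun h => h x) f0.
have [_ fk _ _] := fS; apply: fk; by rewrite cards_eq0.
Qed.

(** Gauge fixing: subtracting an exact form makes the cocycle divergence-free without changing its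
    image under [d1]. The first Clifford contraction then shows it to be harmonic, hence zero. *)
Lemma infinitesimally_rigid_holds : infinitesimally_rigid rho.
Proof.
move=> a [aS da]; have [sa ka soa aE] := (equivariant_section _ _).1 aS.
pose al k x := a x [set k]%SET.
have tal k : twist (al k) by exact: section_twisted aS.
have sal k : smooth (al k) by case: (tal k).
pose div x := \sum_k partial k (al k) x.
have tdiv : twist div by apply: twisted_sum => k _; exact: twisted_partial.
have [phi tphi Lphi] := twisted_poisson tt tsym tC tfix tdiv.
have [sphi sophi _] := tphi.
have phiE : equivariant (sgn finset.set0) phi.
  apply: (equivariant_solution tphi Lphi).
  (* The derivative and the component in direction [k] each contribute the sign s_k, so the
     divergence carries the trivial character. *)
  apply: equivariant_sum => k g s gs ss x.
  have := equivariant_partial k (sal k) (aE [set k]%SET) gs ss x.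
  by rewrite /sgn big_set1 ss big_set0.
pose f x : form 8 V := [ffun J : {set 'I_8} => if J == finset.set0 then phi x else 0].
have f0 : (fun x => f x finset.set0) = phi by apply/funext => x; rewrite ffunE eqxx.
have fN J : J != finset.set0 -> (fun x => f x J) = fun=> 0.
  by move=> /negPf J0; apply/funext => x; rewrite ffunE J0.
exists f.
  apply/equivariant_section; split.
  - move=> J; have [->|/fN->] := eqVneq J finset.set0; first by rewrite f0.
    exact: smooth_cst.
  - by move=> x J; rewrite cards_eq0 ffunE => /negPf ->.
  - move=> x J; rewrite ffunE; case: ifP => _; first exact: sophi.
    by rewrite /so_alg /= trmx0 oppr0.
  - move=> J; have [->|/fN->] := eqVneq J finset.set0; first by rewrite f0.
    by move=> g s _ _ x; rewrite scaler0 Ad_0.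
pose b k x := al k x - partial k phi x.
have tb k : twist (b k) by apply: twistedB => //; exact: twisted_partial.
have sb k : smooth (b k) by case: (tb k).
(* The first part is the cocycle condition paired with [octform j]; the exact part drops out because
   second derivatives are symmetric and [oct] is antisymmetric. *)
have octb j x : \sum_k \sum_l oct R j k l *: partial k (b l) x = 0.
  have S1 : \sum_k \sum_l oct R j k l *: partial k (al l) x = 0.
    have := congr1 (fun h => pairing (octform R j) (h x)) da.
    rewrite /= /d1 pi27E; last by apply: ext_d_kform.
    rewrite pairing_octform_octproj pairing_ext_d => ->.
    by rewrite /pairing big1 // => I _; rewrite [X in _ *: X]ffunE scaler0.
  have S2 : \sum_k \sum_l oct R j k l *: partial k (partial l phi) x = 0.
    rewrite -oct_antisym_sum big1 // => k _; rewrite big1 // => l _.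
    by rewrite (twisted_partialC tt _ _ tphi) subrr scaler0.
  transitivity (\sum_k \sum_l oct R j k l *: partial k (al l) x -
    \sum_k \sum_l oct R j k l *: partial k (partial l phi) x); last first.
    by rewrite S1 S2 subrr.
  rewrite -sumrB; apply: eq_bigr => k _.
  rewrite -sumrB; apply: eq_bigr => l _; rewrite partialB ?scalerBr //.
  exact: smooth_partial.
have divb x : \sum_k partial k (b k) x = 0.
  transitivity (div x - lap phi x); last by rewrite Lphi subrr.
  rewrite -sumrB; apply: eq_bigr => k _.
  by rewrite partialB //; exact: smooth_partial.
(* By the contraction, [lap (b k)] is a combination of first derivatives of the quantities in [octb]
   and [divb], which vanish identically. *)
have b0 k : b k = fun=> 0.
  apply: (twisted_harmonic_eq0 tt tfix (tb k)); apply/funext => x.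
  rewrite /lap -(dual_clifford_contraction
    (H := fun p q l => partial p (partial q (b l)) x));
    last by move=> p q l; rewrite (twisted_partialC tt _ _ (tb l)).
  rewrite [X in _ + X](_ : _ =
    partial k (fun y => \sum_l partial l (b l) y) x); last first.
    by rewrite partial_sum // => l _; exact: smooth_partial.
  rewrite (funext divb) partial_cst addr0 big1 // => j _; rewrite big1 // => p _.
  rewrite (_ : \sum_q _ =
    partial p (fun y => \sum_q \sum_l oct R j q l *: partial q (b l) y) x).
    by rewrite (funext (octb j)) partial_cst scaler0.
  have so q l : smooth (fun y => oct R j q l *: partial q (b l) y).
    by apply: smoothZ; exact: smooth_partial.
  rewrite partial_sum => [|q _]; last by apply: smooth_sum => l _.
  apply: eq_bigr => q _; rewrite partial_sum => [|l _] //.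
  by apply: eq_bigr => l _; rewrite partialZ //; exact: smooth_partial.
apply/funext => x; apply/ffunP => J.
have [J1|J1] := eqVneq #|J| 1%N; last first.
  rewrite ka //; apply: (ext_d_kform (d := 0)) => // y I; rewrite cards_eq0 => /fN.
  by move=> /(congr1 (fun h => h y)).
have /cards1P[k ->] : #|J| == 1%N by rewrite J1.
rewrite ext_d_set1 f0; apply/esym/eqP; rewrite -subr_eq0; apply/eqP.
by have := congr1 (fun h => h x) (b0 k).
Qed.

(* [w = lap v] is, up to a constant factor, the image of the codifferential of
   [v], since [v] lies in Lambda^2_7 by uniqueness. *)
Lemma unobstructed_holds : unobstructed rho.
Proof.
move=> w [wS w27]; have [sw kw sow wE] := (equivariant_section _ _).1 wS.
have tw J : twist (fun x => w x J) by exact: section_twisted wS.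
have vP J : {phi | twist phi & lap phi = fun x => w x J}.
  by have [phi [H1 H2]] := cid2 (twisted_poisson tt tsym tC tfix (tw J)); exists phi.
pose v x : form 8 V := [ffun J : {set 'I_8} => s2val (vP J) x].
have vJ J : (fun x => v x J) = s2val (vP J) by apply/funext => x; rewrite ffunE.
have tv J : twist (fun x => v x J) by rewrite vJ; exact: s2valP (vP J).
have Lv J : lap (fun x => v x J) = fun x => w x J by rewrite vJ; exact: s2valP' (vP J).
have sv J : smooth (fun x => v x J) by case: (tv J).
have vE J : equivariant (sgn J) (fun x => v x J).
  exact: (equivariant_solution (tv J) (Lv J) (wE J)).
pose y j x := pairing (octform R j) (v x).
have ty j : twist (y j) by apply: twisted_sum => J _; exact: twistedZ.
have sy j : smooth (y j) by case: (ty j).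
have Ly j : lap (y j) = fun x => pairing (octform R j) (w x).
  rewrite lap_sum => [|J _]; last exact: smoothZ.
  by apply/funext => x; apply: eq_bigr => J _; rewrite lapZ // Lv.
have proj (f : E -> form 8 V) J x : octproj (f x) J =
    4^-1 *: \sum_j octform R j J *: pairing (octform R j) (f x) by rewrite ffunE.
have vproj J : (fun x => 4^-1 *: \sum_j octform R j J *: y j x) = fun x => v x J.
  pose u x := 4^-1 *: (\sum_j octform R j J *: y j x) - v x J.
  have tS : twist (fun x => \sum_j octform R j J *: y j x).
    by apply: twisted_sum => j _; exact: twistedZ.
  have sS : smooth (fun x => \sum_j octform R j J *: y j x) by case: tS.
  have u0 : u = fun=> 0.
    apply: (twisted_harmonic_eq0 tt tfix (twistedB (twistedZ _ tS) (tv J))).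
    rewrite lapB //; last exact: smoothZ.
    rewrite lapZ // lap_sum => [|j _]; last exact: smoothZ.
    apply/funext => x; have /Lambda27P[_ /(congr1 (fun h : form 8 V => h J))] := w27 x.
    rewrite Lv => <-; rewrite proj; apply/eqP; rewrite subr_eq0; apply/eqP.
    by congr (_ *: _); apply: eq_bigr => j _; rewrite lapZ // Ly.
  apply/funext => x; apply/eqP; rewrite -subr_eq0; apply/eqP.
  by have := congr1 (fun h => h x) u0.
(* [b] is the antisymmetric matrix of [v]. By [vproj] its entries are, up to sign, components of
   [v], from which their equivariance is read off. *)
pose b k l x := 4^-1 *: \sum_j oct R j k l *: y j x.
have bE k l : equivariant (fun s => s 0 k * s 0 l) (b k l).
  have lt (k' l' : 'I_8) : (k' < l')%N ->
      equivariant (fun s => s 0 k' * s 0 l') (b k' l').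
    move=> kl; have -> : b k' l' = fun x => v x [set k'; l']%SET.
      rewrite -vproj; apply/funext => x; congr (_ *: _).
      by apply: eq_bigr => j _; rewrite octform_pair.
    move=> g s gs ss x; have := vE [set k'; l']%SET g s gs ss x.
    by rewrite /sgn big_setU1 ?big_set1 // inE -val_eqE /= ltn_eqF.
  have [kl|lk|/val_inj ->] := ltngtP k l; first exact: lt.
    have -> : b k l = fun x => (-1) *: b l k x.
      apply/funext => x; rewrite /b scalerA mulrC -scalerA scaleN1r -sumrN.
      by congr (_ *: _); apply: eq_bigr => j _; rewrite (oct_antisym R j l k) scaleNr.
    by move=> g s gs ss x; rewrite mulrC; exact: (equivariantZ _ (lt _ _ lk)).
  have -> : b l l = fun=> 0.
    apply/funext => x; rewrite /b big1 ?scaler0 // => j _.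
    by rewrite oct_diag scale0r.
  by move=> g s _ _ x; rewrite scaler0 Ad_0.
have tb k l : twist (b k l).
  by apply: twistedZ; apply: twisted_sum => j _; exact: twistedZ.
have sb k l : smooth (b k l) by case: (tb k l).
(* The codifferential of [v] up to sign and scale. The 4 cancels the normalisation in [b], so [a m]
   is the sum of the [oct R j k m *: partial k (y j)] required by [clifford_contraction]. *)
pose a m x := 4 *: \sum_k partial k (b k m) x.
have ta m : twist (a m).
  by apply: twistedZ; apply: twisted_sum => k _; exact: twisted_partial.
have aE m : equivariant (sgn [set m]%SET) (a m).
  apply: equivariantZ; apply: equivariant_sum => k g s gs ss x.
  have := equivariant_partial k (sb k m) (bE k m) gs ss x.
  by rewrite mulrA ss mul1r /sgn big_set1.
pose f x : form 8 V := [ffun J : {set 'I_8} => \sum_(m | J == [set m]%SET) a m x].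
have f1 m : (fun x => f x [set m]%SET) = a m.
  apply/funext => x; rewrite ffunE (big_pred1 m) // => k.
  by rewrite (inj_eq set1_inj) eq_sym.
have fN (J : {set 'I_8}) : #|J| != 1%N -> (fun x => f x J) = fun=> 0.
  move=> J1; apply/funext => x; rewrite ffunE big_pred0 // => k.
  by apply/negbTE; apply: contra J1 => /eqP ->; rewrite cards1.
have cases (J : {set 'I_8}) : (exists m, J = [set m]%SET) \/ #|J| != 1%N.
  by case: (boolP (#|J| == 1%N)) => [/cards1P|]; [left|right].
exists f.
  apply/equivariant_section; split.
  - move=> J; have [[m ->]|/fN->] := cases J; last exact: smooth_cst.
    by rewrite f1; case: (ta m).
  - by move=> x J /fN /(congr1 (fun h => h x)).
  - move=> x J; have [[m ->]|/fN/(congr1 (fun h => h x)) /= ->] := cases J.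
      by have := congr1 (fun h => h x) (f1 m) => /= ->; have [_ + _] := ta m; exact.
    by rewrite /so_alg /= trmx0 oppr0.
  - move=> J; have [[m ->]|/fN->] := cases J; first by rewrite f1.
    by move=> g s _ _ x; rewrite scaler0 Ad_0.
apply/funext => x; rewrite /d1 pi27E; last first.
  by apply: (ext_d_kform (d := 1)) => z J /fN /(congr1 (fun h => h z)).
(* Both sides are now values of [octproj], so it suffices to compare pairings with each [octform i];
   that of [w] is the Laplacian of [y i]. *)
have /Lambda27P[_ <-] := w27 x; apply/ffunP => J; rewrite !proj.
congr (_ *: _); apply: eq_bigr => i _; congr (_ *: _).
rewrite pairing_ext_d; have := congr1 (fun h => h x) (Ly i) => /= <-.
rewrite /lap -(clifford_contraction (G := fun j p k => partial p (partial k (y j)) x));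
  last by move=> j p k; rewrite (twisted_partialC tt _ _ (ty j)).
apply: eq_bigr => p _; apply: eq_bigr => m _; congr (_ *: _).
have -> : (fun z => f z [set m]%SET) =
    fun z => \sum_j \sum_k oct R j k m *: partial k (y j) z.
  rewrite f1; apply/funext => z; rewrite /a exchange_big scaler_sumr.
  apply: eq_bigr => k _ /=.
  have so j : smooth (fun z => oct R j k m *: y j z) by exact: smoothZ.
  rewrite partialZ; last by apply: smooth_sum => j _.
  rewrite partial_sum // scalerA mulfV ?pnatr_eq0 // scale1r.
  by apply: eq_bigr => j _; rewrite partialZ.
have so j k : smooth (fun z => oct R j k m *: partial k (y j) z).
  by apply: smoothZ; exact: smooth_partial.
rewrite partial_sum => [|j _]; last by apply: smooth_sum => k _.
apply: eq_bigr => j _; rewrite partial_sum => [|k _] //.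
by apply: eq_bigr => k _; rewrite partialZ //; exact: smooth_partial.
Qed.

End Validity.

Theorem proposition7p23 (R : realType)
    (rho : {multiplicative pi1orb R -> SO R 4})
    (rho_alpha : rho (alpha R) = 1%g)
    (rho_beta : rho (beta R) = 1%g)
    (rho_comm : commute (rho (gamma R)) (rho (delta R)))
    (rho_nontrivial : rho (gamma R) <> 1%g \/ rho (delta R) <> 1%g)
    (klein : exists K : set (SO R 4),
       [/\ klein_four K,
           K `<=` generated (range (fun i : 'I_8 => rho (tau R i))) &
           ~ K (SO4_opp1 R)]) :
  valid_for_construction rho.
Proof.
split; [exact: irreducible_holds|exact: infinitesimally_rigid_holds|].
exact: unobstructed_holds.
Qed.
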